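(* There exists a constant $d'>0$ such that for all integers $d_1>d_2>d'$ the following holds: with probability tending to $1$ as $n\to\infty$, the random graph $G\sim\mathcal{G}(n,d_1,d_2)$ with true partition $(\mathcal{A},\mathcal{B})$ has a unique partition, i.e. the only subsets $V\subset[2n]$ with $|V|=n$ such that the induced subgraphs $G_V$ and $G_{[2n]\setminus V}$ are both $d_1$-regular and the edges of $G$ between $V$ and $[2n]\setminus V$ form a $d_2$-regular bipartite graph are $V=\mathcal{A}$ and $V=\mathcal{B}$.
   Context: The regular stochastic block model $\mathcal{G}(n,d_1,d_2)$ is the random graph on vertex set $[2n]$ obtained as follows: choose an equipartition $(\mathcal{A},\mathcal{B})$ of $[2n]$ (so $|\mathcal{A}|=|\mathcal{B}|=n$) uniformly at random among all equipartitions; independently choose a uniformly random simple $d_1$-regular graph on $\mathcal{A}$ and a uniformly random simple $d_1$-regular graph on $\mathcal{B}$; independently, connect $\mathcal{A}$ and $\mathcal{B}$ by a uniformly random simple $d_2$-regular bipartite graph with parts $\mathcal{A}$ and $\mathcal{B}$. The graph is the union of these three graphs; $(\mathcal{A},\mathcal{B})$ is called the true partition. For $V\subset[2n]$, $G_V$ denotes the subgraph of $G$ induced on $V$. Only values of $n$ with $nd_1$ even are considered. *)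

(* Defs.v *)
From mathcomp Require Import all_boot all_order all_algebra.
Set Implicit Arguments. Unset Strict Implicit. Unset Printing Implicit Defensive.
Import GRing.Theory Num.Theory.

Section Graphs.
Variable T : finType.

Definition simple_edges (E : {set T * T}) : bool :=
  [forall x, forall y, ((x, y) \in E) == ((y, x) \in E)] &&
  [forall x, (x, x) \notin E].

Definition nbr_in (E : {set T * T}) (v : T) (S : {set T}) : nat :=
  #|[set u in S | (v, u) \in E]|.

Definition regular_on (A : {set T}) (d : nat) (E : {set T * T}) : bool :=
  [&& E \subset setX A A, simple_edges E & [forall v in A, nbr_in E v A == d]].

Definition bip_regular (A B : {set T}) (d : nat) (E : {set T * T}) : bool :=
  [&& E \subset (setX A B :|: setX B A), simple_edges E,
      [forall v in A, nbr_in E v B == d] & [forall v in B, nbr_in E v A == d]].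

Definition sbm_partition (n d1 d2 : nat) (G : {set T * T}) (V : {set T}) : bool :=
  [&& #|V| == n,
      regular_on V d1 [set e in G | (e.1 \in V) && (e.2 \in V)],
      regular_on (~: V) d1 [set e in G | (e.1 \in ~: V) && (e.2 \in ~: V)] &
      bip_regular V (~: V) d2
        [set e in G | ((e.1 \in V) && (e.2 \in ~: V)) || ((e.1 \in ~: V) && (e.2 \in V))]].

Definition unique_partition (n d1 d2 : nat) (G : {set T * T}) (A : {set T}) : bool :=
  [forall V : {set T}, sbm_partition n d1 d2 G V ==> (V == A) || (V == ~: A)].

End Graphs.

Unset Implicit Arguments.

Notation vtx n := ('I_(2 * n)).

(* Given the true part A (B = ~: A), an outcome is a triple (G1, G2, H) of a
   d1-regular graph on A, a d1-regular graph on B and a d2-regular bipartite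
   graph between A and B; the three are independent and uniform, i.e. the
   triple is uniform on the product set below. *)
Definition sbm_outcomes (n d1 d2 : nat) (A : {set vtx n}) :
  {set {set vtx n * vtx n} * {set vtx n * vtx n} * {set vtx n * vtx n}} :=
  [set t | [&& regular_on A d1 t.1.1, regular_on (~: A) d1 t.1.2 &
              bip_regular A (~: A) d2 t.2]].

Definition sbm_graph n (t : {set vtx n * vtx n} * {set vtx n * vtx n} * {set vtx n * vtx n}) :=
  t.1.1 :|: t.1.2 :|: t.2.

(* Probability that G ~ G(n,d1,d2) with true partition (A, ~:A) has a unique
   partition: A is uniform among n-subsets of [2n], then the triple is uniform
   on sbm_outcomes. *)
Definition prob_unique (n d1 d2 : nat) : rat :=
  (\sum_(A : {set vtx n} | #|A| == n)
     ((#|[set t in sbm_outcomes n d1 d2 A |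
          unique_partition n d1 d2 (sbm_graph n t) A]|%:R : rat)
      / (#|sbm_outcomes n d1 d2 A|%:R)))
  / (#|[set A : {set vtx n} | #|A| == n]|%:R).

(* Main.v *)
Require Import Defs.
From mathcomp Require Import all_boot all_order all_algebra.
From mathcomp Require Import zify ring lra.
Import Order.TTheory GRing.Theory Num.Theory.
Set Implicit Arguments. Unset Strict Implicit. Unset Printing Implicit Defensive.

(** The only randomness needed is that of the bipartite graph [H]. If [V] is
    another part, put [X = A \ V] and [Y = V \ A], both of size [m], and
    [m <= n/2] after possibly complementing [V]. Regularity inside [V] and inside
    its complement then prescribes, for each [v] in [A], the number [s v] of
    [H]-neighbours of [v] in [Y], and [s] depends only on [X] and the graph on
    [A]. It remains to see that the proportion of bipartite graphs with prescribed
    numbers [s] beats the [C(n,m)^2] choices of [(X, Y)], for which there are two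
    devices.
    - For [m <= n/8d], switching edges one at a time shows that [k] given edges
      occur with probability at most [(2d/n)^k], whence a bound [(2dm/n)^(dm)].
    - For larger [m], pair up vertices [v, w] of [A]. If their neighbourhoods are
      disjoint, redistributing the union among them makes [|N(v) \cap Y|]
      hypergeometric, independently for all pairs. Averaging over shifts of the
      pairing, all but [d^2] pairs are disjoint. Depending on whether [s] vanishes
      on half of [A], or [m] is small, or [m] is of order [n], one gains
      [2^(-s v)], [2/3] or an arbitrarily small constant per pair. *)

(** * Bipartite graphs as families of rows *)

Section RowFamilies.
Variables (T : finType) (A B : {set T}) (d : nat).
Implicit Types (f : {ffun T -> {set T}}) (v w : T) (S : {set T}).

(** Encodes a [d]-regular bipartite graph by the neighbourhoods of the vertices of [A]. Rows outside
    [A] are forced to be empty, so that each graph has a single code. *)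
Definition row_families : {set {ffun T -> {set T}}} :=
  [set f : {ffun T -> {set T}} | [&& [forall v, f v \subset (if v \in A then B else set0)],
               [forall v in A, #|f v| == d] &
               [forall b in B, \sum_v (b \in f v) == d]]].
Local Notation Om := row_families.

Lemma row_familiesP f :
  reflect [/\ forall v, v \in A -> f v \subset B, forall v, v \notin A -> f v = set0,
              forall v, v \in A -> #|f v| = d &
              forall b, b \in B -> \sum_v (b \in f v) = d] (f \in Om).
Proof.
rewrite inE; apply: (iffP and3P) => [[/forallP h1 /forall_inP h2 /forall_inP h3]|[h1 h2 h3 h4]].
  split=> [v vA|v vA|v /h2/eqP //|b /h3/eqP //].
    by have := h1 v; rewrite vA.
  by have := h1 v; rewrite (negPf vA) subset0 => /eqP.
split; first apply/forallP => v.
- by case: (boolP (v \in A)) => [/h1|/h2 ->].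
- by apply/forall_inP => v /h3 ->.
- by apply/forall_inP => b /h4 ->.
Qed.

(** Both devices, switching and redistribution, change a family in two rows only. *)
Definition upd2 f v w S1 S2 : {ffun T -> {set T}} :=
  [ffun x => if x == v then S1 else if x == w then S2 else f x].

Lemma upd2_1 f v w S1 S2 : upd2 f v w S1 S2 v = S1.
Proof. by rewrite ffunE eqxx. Qed.

Lemma upd2_2 f v w S1 S2 : v != w -> upd2 f v w S1 S2 w = S2.
Proof. by move=> vw; rewrite ffunE eqxx eq_sym (negPf vw). Qed.

Lemma upd2_other f v w S1 S2 x : x != v -> x != w -> upd2 f v w S1 S2 x = f x.
Proof. by rewrite ffunE => /negPf -> /negPf ->. Qed.

Lemma upd2_upd2 f v w S1 S2 S3 S4 :
  upd2 (upd2 f v w S1 S2) v w S3 S4 = upd2 f v w S3 S4.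
Proof. by apply/ffunP => x; rewrite !ffunE; case: eqP => // _; case: eqP. Qed.

Lemma upd2_id f v w : upd2 f v w (f v) (f w) = f.
Proof. by apply/ffunP => x; rewrite !ffunE; case: eqP => [->//|_]; case: eqP => [->|]. Qed.

(** Column sums survive because [S1] and [S2] together cover each element as often as the two old
    rows did. *)
Lemma upd2_in f v w S1 S2 : f \in Om -> v \in A -> w \in A -> v != w ->
  #|S1| = d -> #|S2| = d ->
  (forall x, (x \in S1) + (x \in S2) = (x \in f v) + (x \in f w)) ->
  upd2 f v w S1 S2 \in Om.
Proof.
move=> /row_familiesP[h1 h2 h3 h4] vA wA vw c1 c2 hx.
have sub S : (S = S1) \/ (S = S2) -> S \subset B.
  move=> hS; apply/subsetP => x xS; have := hx x.
  have := subsetP (h1 _ vA) x; have := subsetP (h1 _ wA) x.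
  case: (boolP (x \in f v)) => [_ _ /(_ isT) //|_]; case: (boolP (x \in f w)) => [_ /(_ isT) //|_] _ _.
  by case: hS xS => -> -> /eqP; rewrite ?addn1.
apply/row_familiesP; split=> [x xA|x xA|x xA|b bB].
- rewrite ffunE; case: eqP => _; first by apply: sub; left.
  by case: eqP => _; [apply: sub; right | apply: h1].
- rewrite upd2_other ?h2 //; first by apply: contraNneq xA => ->.
  by apply: contraNneq xA => ->.
- by rewrite ffunE; case: eqP => // _; case: eqP => // _; apply: h3.
- rewrite -(h4 b bB) (bigD1 v) //= (bigD1 w) ?(eq_sym w) //=.
  rewrite [RHS](bigD1 v) //= [X in _ = _ + X](bigD1 w) ?(eq_sym w) //=.
  rewrite upd2_1 upd2_2 // !addnA hx; congr (_ + _).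
  by apply: eq_bigr => x /andP[xv xw]; rewrite upd2_other.
Qed.

Lemma sum_mem_row (f : {ffun T -> {set T}}) x : \sum_v (x \in f v) = #|[set v | x \in f v]|.
Proof. by rewrite -big_mkcond sum1_card cardsE. Qed.

Lemma card_col f b : f \in Om -> #|[set v | b \in f v]| <= d.
Proof.
move=> /row_familiesP[h1 h2 h3 h4]; rewrite -sum_mem_row.
case: (boolP (b \in B)) => [/h4 -> //|bB].
rewrite big1 // => v _; case: (boolP (v \in A)) => [/h1/subsetP/(_ b)|/h2 ->]; last by rewrite inE.
by case: (b \in f v) bB => // /negPf -> /(_ isT).
Qed.

End RowFamilies.

(** * Double counting and the union bound *)

Lemma card_pairs (T1 T2 : finType) (P : T1 -> T2 -> bool) :
  #|[set p : T1 * T2 | P p.1 p.2]| = \sum_x #|[set y | P x y]|.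
Proof.
rewrite -sum1_card (eq_bigl (fun p => P p.1 p.2)); last by move=> p; rewrite inE.
rewrite -(pair_big_dep xpredT P (fun _ _ => 1)) /=.
by apply: eq_bigr => x _; rewrite sum1_card cardsE.
Qed.

Lemma card_pairs_swap (T1 T2 : finType) (P : T1 -> T2 -> bool) :
  #|[set p : T1 * T2 | P p.1 p.2]| = \sum_y #|[set x | P x y]|.
Proof.
rewrite card_pairs; under eq_bigr do rewrite -sum1_card big_mkcond.
rewrite exchange_big /=; apply: eq_bigr => y _; rewrite -sum1_card [RHS]big_mkcond /=.
by apply: eq_bigr => x _; rewrite !inE.
Qed.

Lemma leq_card_bigcup (I S : finType) (P : {set I}) (F : I -> {set S}) :
  #|\bigcup_(i in P) F i| <= \sum_(i in P) #|F i|.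
Proof.
elim/big_rec2: _ => [|i m X _ h]; first by rewrite cards0.
by apply: leq_trans (leq_card_setU _ _).1 _; rewrite leq_add2l.
Qed.

(** * Switching edges one at a time *)

Section EdgeSwitching.
Variables (T : finType) (A B : {set T}) (d : nat).
Local Notation Om := (row_families A B d).
Implicit Types (f : {ffun T -> {set T}}) (E : {set T * T}).

Definition containing E := [set f in Om | [forall e in E, e.2 \in f e.1]].

Lemma card_edges f : f \in Om -> #|[set p : T * T | p.2 \in f p.1]| = #|A| * d.
Proof.
move=> /row_familiesP[h1 h2 h3 h4]; rewrite (card_pairs (fun v y => y \in f v)) (bigID [in A]) /= addnC.
rewrite big1 => [|v vA]; last by rewrite h2 //; apply: eq_card0 => x; rewrite !inE.
rewrite add0n -sum_nat_const; apply: eq_bigr => v /h3 <-.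
by apply: eq_card => x; rewrite inE.
Qed.

(** Of the [#|A| * d] edges, at most [#|E|] lie in [E], at most [d ^ 2] end in an element of row
    [a], and at most [d ^ 2] start in one of the at most [d] rows containing [b]. *)
Lemma card_switch_partners f E a b : f \in Om -> a \in A ->
  #|A| * d - #|E| - 2 * d ^ 2 <=
  #|[set p : T * T | [&& p.2 \in f p.1, p \notin E, p.2 \notin f a & b \notin f p.1]]|.
Proof.
move=> fO aA; have fE := card_edges fO; have fC := card_col _ fO.
case/row_familiesP: (fO) => h1 h2 h3 h4.
have rowle v : #|f v| <= d.
  by case: (boolP (v \in A)) => [/h3->//|/h2->]; rewrite cards0.
set G := [set p : T * T | _].
pose C1 := [set p : T * T | (p.2 \in f a) && (p.2 \in f p.1)].
pose C2 := [set p : T * T | (b \in f p.1) && (p.2 \in f p.1)].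
have c1 : #|C1| <= d ^ 2.
  rewrite (card_pairs_swap (fun x y => (y \in f a) && (y \in f x))).
  rewrite (bigID (fun y => y \in f a)) /= [X in _ + X]big1 => [|y /negPf ya]; last first.
    by apply: eq_card0 => x; rewrite inE ya.
  rewrite addn0 (leq_trans (n := \sum_(y in f a) d)) //; last by rewrite sum_nat_const h3.
  apply: leq_sum => y ya; apply: leq_trans (fC y).
  by apply: subset_leq_card; apply/subsetP => x; rewrite !inE ya.
have c2 : #|C2| <= d ^ 2.
  rewrite (card_pairs (fun x y => (b \in f x) && (y \in f x))).
  rewrite (bigID (fun x => b \in f x)) /= [X in _ + X]big1 => [|x /negPf ya]; last first.
    by apply: eq_card0 => y; rewrite inE ya.
  rewrite addn0 (leq_trans (n := \sum_(x | b \in f x) d)) //; last first.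
    by rewrite sum_nat_const leq_mul2r; apply/orP; right; have := fC b; rewrite cardsE.
  apply: leq_sum => x xb; apply: leq_trans (rowle x).
  by apply: subset_leq_card; apply/subsetP => y; rewrite !inE xb.
have : [set p : T * T | p.2 \in f p.1] \subset (G :|: (E :|: (C1 :|: C2))).
  apply/subsetP => p; rewrite !inE => ->; rewrite !andbT /=.
  by case: (p \in E); case: (p.2 \in f a); case: (b \in f p.1).
move/subset_leq_card; rewrite fE => h.
have aux (M e D g x1 x2 x12 y : nat) :
  x1 <= D -> x2 <= D -> x12 <= x1 + x2 -> y <= e + x12 -> M <= g + y -> M - e - 2 * D <= g by lia.
exact: aux c1 c2 (leq_card_setU _ _).1 (leq_card_setU _ _).1 (leq_trans h (leq_card_setU _ _).1).
Qed.

(** Replacing the edges [(a, b)], [(c, g)] by [(a, g)], [(c, b)]: many choices of [(c, g)]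
    forwards, at most [d ^ 2] backwards. *)
Lemma containing_switch E a b : a \in A -> b \in B -> (a, b) \notin E ->
  #|containing ((a, b) |: E)| * (#|A| * d - #|E| - 2 * d ^ 2) <= d ^ 2 * #|containing E|.
Proof.
move=> aA bB abE.
pose ok f (p : T * T) := [&& p.2 \in f p.1, p \notin E, p.2 \notin f a & b \notin f p.1].
pose D := [set q : {ffun T -> {set T}} * (T * T) |
            (q.1 \in containing ((a, b) |: E)) && ok q.1 q.2].
pose sw (q : {ffun T -> {set T}} * (T * T)) :=
  (upd2 q.1 a q.2.1 (q.2.2 |: (q.1 a :\ b)) (b |: (q.1 q.2.1 :\ q.2.2)), q.2).
pose D' := [set q : {ffun T -> {set T}} * (T * T) |
            (q.1 \in containing E) && ((q.2.2 \in q.1 a) && (b \in q.1 q.2.1))].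
have inD q : q \in D -> [/\ q.1 \in Om, b \in q.1 a, forall e, e \in E -> e.2 \in q.1 e.1 & ok q.1 q.2].
  rewrite inE => /andP[]; rewrite inE => /andP[-> /forall_inP h] ->.
  by split=> // [|e eE]; [have := h (a, b) | have := h e]; rewrite !inE ?eqxx ?eE ?orbT //; apply.
have ne q : q \in D -> a != q.2.1.
  by move=> /inD[_ _ _ /and4P[h1 _ h2 _]]; apply: contraNneq h2 => ->.
have Ale : #|D| <= #|D'|.
  rewrite -(card_in_imset (f := sw) (D := D)); last first.
    (* Given [(c, g)], the old rows [a] and [c] can be read off the new ones: whether they contain
       [g] and [b] is the same for all members of [D]. *)
    move=> [f [c g]] [f' [c' g']] hq hq' [e1 e2 e3].
    have := ne _ hq; have := ne _ hq'; have := inD _ hq; have := inD _ hq'.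
    move: e1; rewrite /= -{}e2 -{}e3 /ok /= => e1 [_ b' _ /and4P[k1 k2 k3 k4]].
    move=> [_ b1 _ /and4P[l1 l2 l3 l4]] ac _; congr (_, _).
    rewrite -(upd2_id f a c) -(upd2_id f' a c).
    have ea : f a = f' a.
      have : upd2 f a c (g |: (f a :\ b)) (b |: (f c :\ g)) a = upd2 f' a c (g |: (f' a :\ b)) (b |: (f' c :\ g)) a by rewrite e1.
      rewrite !upd2_1 => /setP h; apply/setP => x; have := h x; rewrite !inE.
      case: (eqVneq x g) => [->|_] /=; first by rewrite (negPf k3) (negPf l3).
      by case: (eqVneq x b) => [->|_] //=; rewrite b1 b'.
    have ec : f c = f' c.
      have : upd2 f a c (g |: (f a :\ b)) (b |: (f c :\ g)) c = upd2 f' a c (g |: (f' a :\ b)) (b |: (f' c :\ g)) c by rewrite e1.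
      rewrite !upd2_2 // => /setP h; apply/setP => x; have := h x; rewrite !inE.
      case: (eqVneq x b) => [->|_] /=; first by rewrite (negPf k4) (negPf l4).
      by case: (eqVneq x g) => [->|_] //=; rewrite k1 l1.
    rewrite -ea -ec -(upd2_upd2 f a c (g |: (f a :\ b)) (b |: (f c :\ g))).
    by rewrite [in LHS]e1 upd2_upd2.
  apply: subset_leq_card; apply/subsetP => _ /imsetP[[f [c g]] hq ->].
  have ac := ne _ hq; have [fO ab hE /and4P[/= k1 k2 k3 k4]] := inD _ hq.
  rewrite /= in ac fO ab hE.
  have gb : g != b by apply: contraNneq k3 => ->.
  have [h1 h2 h3 h4] := row_familiesP _ _ _ _ fO.
  have cA : c \in A by apply: contraLR k1 => /h2->; rewrite inE.
  have -> : forall q, (q \in D') = (q.1 \in containing E) && ((q.2.2 \in q.1 a) && (b \in q.1 q.2.1)).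
    by move=> q; rewrite inE.
  rewrite /= upd2_1 upd2_2 // (_ : g \in _) ?andbT; last by rewrite !inE eqxx.
  rewrite (_ : b \in _) ?andbT; last by rewrite !inE eqxx.
  rewrite inE; apply/andP; split.
    apply: upd2_in => //.
    - by rewrite cardsU1 !inE (negPf k3) andbF -(h3 a aA) [in RHS](cardsD1 b) ab.
    - by rewrite cardsU1 !inE (negPf k4) andbF -(h3 c cA) [in RHS](cardsD1 g) k1.
    - move=> x; rewrite !inE; case: (eqVneq x g) => [->|xg] /=.
        by rewrite (negPf gb) (negPf k3) k1.
      by case: (eqVneq x b) => [->|//] /=; rewrite ab (negPf k4).
  apply/forall_inP => [[x y] /= xyE]; have := hE _ xyE; rewrite /= ffunE.
  case: eqP xyE => [-> ayE ya|_].
    by rewrite !inE ya andbT; have -> : y != b by [apply: contraNneq abE => <-]; rewrite orbT.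
  case: eqP => [-> cyE yc|//].
  by rewrite !inE yc andbT; have -> : y != g by [apply: contraNneq k2 => <-]; rewrite orbT.
have Dge : #|containing ((a, b) |: E)| * (#|A| * d - #|E| - 2 * d ^ 2) <= #|D|.
  rewrite (card_pairs (fun f p => (f \in containing ((a, b) |: E)) && ok f p)).
  rewrite (bigID [in containing ((a, b) |: E)]) /=.
  apply: leq_trans (leq_addr _ _).
  rewrite -[X in X <= _]sum_nat_const; apply: leq_sum => f fO.
  have fO' : f \in Om by move: fO; rewrite inE => /andP[].
  apply: leq_trans (card_switch_partners E b fO' aA) _.
  by apply: subset_leq_card; apply/subsetP => p; rewrite inE => okp; rewrite inE fO.
apply: leq_trans Dge (leq_trans Ale _).
rewrite (card_pairs (fun f (p : T * T) => (f \in containing E) && ((p.2 \in f a) && (b \in f p.1)))).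
rewrite (bigID [in containing E]) /= [X in _ + X]big1 => [|f /negPf fO]; last first.
  by apply: eq_card0 => p; rewrite inE fO.
rewrite addn0 mulnC -sum_nat_const; apply: leq_sum => f fc.
have fO' : f \in Om by move: fc; rewrite inE => /andP[].
have [_ _ h3 _] := row_familiesP _ _ _ _ fO'.
rewrite (eq_card (B := setX [set v | b \in f v] (f a))).
  by rewrite cardsX h3 // leq_mul // (card_col _ fO').
by move=> [x y]; rewrite inE fc /= in_setX inE andbC.
Qed.

Lemma containing0 : containing set0 = Om.
Proof.
apply/setP => f; rewrite inE andb_idr // => _.
by apply/forall_inP => e; rewrite inE.
Qed.

Definition missing E f (Y : {set T}) v := [set y in Y | (y \in f v) && ((v, y) \notin E)].

(** [L] lists, with multiplicity, the rows that still need an element of [Y] outside [E];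
    each step of the induction reveals one of them as a new forced edge. *)
Lemma card_containing_demand (Y : {set T}) (L : seq T) E k : Y \subset B ->
  (forall v, v \in L -> v \in A) -> #|E| + size L <= k ->
  2 * (k + 2 * d ^ 2) <= #|A| * d -> 0 < d ->
  #|[set f in containing E | [forall v, count_mem v L <= #|missing E f Y v|]]|
    * #|A| ^ size L <= (2 * d * #|Y|) ^ size L * #|containing E|.
Proof.
move=> YB + + kA d0; elim: L E => [|v L IH] E LA /= hk.
  rewrite !expn0 muln1 mul1n; apply: subset_leq_card.
  by apply/subsetP => f; rewrite inE => /andP[].
have vA : v \in A by apply: LA; rewrite inE eqxx.
pose G E L := [set f in containing E | [forall v, count_mem v L <= #|missing E f Y v|]].
(* Splits by an element [y] of [Y] that meets the first demand of row [v]. *)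
have hG : G E (v :: L) \subset
    \bigcup_(y in [set y in Y | (v, y) \notin E]) G ((v, y) |: E) L.
  apply/subsetP => f; rewrite inE => /andP[fE /forallP fm].
  have : 0 < #|missing E f Y v| by apply: leq_trans (fm v); rewrite /= eqxx.
  move=> /card_gt0P[y]; rewrite inE => /and3P[yY yf yE].
  apply/bigcupP; exists y; first by rewrite inE yY.
  rewrite inE; apply/andP; split.
    move: fE; rewrite inE => /andP[fO /forall_inP fE]; rewrite inE fO.
    by apply/forall_inP => e; rewrite !inE => /orP[/eqP -> //|/fE].
  apply/forallP => x; have := fm x; rewrite /=.
  case: (eqVneq v x) => [<-|vx] /=.
    rewrite add1n (cardsD1 y) !inE yY yf yE /= add1n ltnS => h; apply: leq_trans h _.
    apply: subset_leq_card; apply/subsetP => z; rewrite !inE => /and4P[zy -> -> h] /=.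
    by rewrite negb_or h andbT; apply: contraNneq zy => -[->].
  rewrite add0n => h; apply: leq_trans h _.
  apply: subset_leq_card; apply/subsetP => z; rewrite !inE => /and3P[-> -> h] /=.
  by rewrite negb_or h andbT; apply: contraNneq vx => -[->].
have hc := leq_trans (subset_leq_card hG) (leq_card_bigcup _ _).
have step y : y \in [set y in Y | (v, y) \notin E] ->
    #|G ((v, y) |: E) L| * #|A| ^ (size L).+1 <=
    (2 * d * #|Y|) ^ size L * (2 * d * #|containing E|).
  rewrite inE => /andP[yY yE]; rewrite expnSr mulnA.
  have hIH := IH ((v, y) |: E) (fun x xL => LA x (mem_behead (s := v :: L) xL)) _.
  have hsz : #|(v, y) |: E| + size L <= k by rewrite cardsU1 yE add1n addSnnS.
  apply: leq_trans (leq_mul (hIH hsz) (leqnn _)) _.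
  rewrite -mulnA leq_mul2l; apply/orP; right.
  (* By [kA] at least half of the [#|A| * d] edges are partners for the switch, so forcing [(v, y)]
     costs a factor [2 * d / #|A|]. *)
  have sw := containing_switch vA (subsetP YB _ yY) yE.
  rewrite -(leq_pmul2r d0) -mulnA; apply: (@leq_trans (2 * (d ^ 2 * #|containing E|))).
    apply: leq_trans (leq_mul (leqnn 2) sw); rewrite [X in _ <= X]mulnCA leq_mul2l; apply/orP; right.
    have aux (M e D K l : nat) : 2 * (K + 2 * D) <= M -> e + l.+1 <= K -> M <= 2 * (M - e - 2 * D) by lia.
    exact: aux kA hk.
  by rewrite -mulnn; nia.
apply: leq_trans (leq_mul hc (leqnn _)) _; rewrite big_distrl /=.
apply: (@leq_trans (\sum_(y in [set y in Y | (v, y) \notin E]) (2 * d * #|Y|) ^ size L * (2 * d * #|containing E|))).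
  exact: leq_sum.
rewrite sum_nat_const.
apply: (@leq_trans (#|Y| * ((2 * d * #|Y|) ^ size L * (2 * d * #|containing E|)))).
  by rewrite leq_mul2r subset_leq_card ?orbT //; apply/subsetP => y; rewrite inE => /andP[].
by apply: eq_leq; rewrite expnS; ring.
Qed.

End EdgeSwitching.

(** * Families with prescribed intersections with [Y] *)

Section Matching.
Variables (T : finType) (A B : {set T}) (d : nat).
Local Notation Om := (row_families A B d).
Implicit Types (f : {ffun T -> {set T}}) (Y : {set T}) (s : T -> nat).

Definition matching Y s := [set f in Om | [forall v in A, #|f v :&: Y| == s v]].

Lemma matchingP Y s f :
  reflect (f \in Om /\ forall v, v \in A -> #|f v :&: Y| = s v) (f \in matching Y s).
Proof.
rewrite [f \in matching _ _]inE; apply: (iffP andP) => -[fO h]; split=> //.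
  by move=> v vA; apply/eqP; apply: (forall_inP h).
by apply/forall_inP => v vA; rewrite h.
Qed.

(** Double count of the edges into [Y], whose columns hold [d] elements each. *)
Lemma matching_sum Y s f : Y \subset B -> f \in matching Y s ->
  \sum_(v in A) s v = d * #|Y|.
Proof.
move=> YB /matchingP[/row_familiesP[h1 h2 h3 h4] m].
under eq_bigr => v vA do rewrite -(m v vA) -sum1_card big_mkcond /=.
rewrite exchange_big /= mulnC -sum_nat_const [RHS]big_mkcond /=.
apply: eq_bigr => y _; case: ifP => yY.
  rewrite -(h4 y (subsetP YB y yY)) [RHS](bigID [in A]) /= [X in _ = _ + X]big1 ?addn0.
    by apply: eq_bigr => v vA; rewrite inE yY andbT; case: (y \in f v).
  by move=> v /h2 ->; rewrite inE.
by rewrite big1 // => v _; rewrite inE yY andbF.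
Qed.

Lemma matching_le Y s f v : f \in matching Y s -> v \in A -> s v <= d.
Proof.
move=> /matchingP[/row_familiesP[_ _ h3 _] m] vA.
by rewrite -(m v vA) -(h3 v vA) subset_leq_card // subsetIl.
Qed.

(** Starting from no forced edge, all [d * #|Y|] edges into [Y] are revealed in turn, each at the
    cost of a factor [2 * d * #|Y| / #|A|]. *)
Lemma card_matching_small Y s : Y \subset B -> 0 < d ->
  2 * (d * #|Y| + 2 * d ^ 2) <= #|A| * d ->
  #|matching Y s| * #|A| ^ (d * #|Y|) <= (2 * d * #|Y|) ^ (d * #|Y|) * #|Om|.
Proof.
move=> YB d0 hA; have [->|[f0 f0m]] := set_0Vmem (matching Y s); first by rewrite cards0.
(* Row [v] is listed once for each of the [s v] elements of [Y] that it must contain. *)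
pose L := flatten [seq nseq (s v) v | v <- enum A].
have sL : size L = d * #|Y|.
  rewrite -(matching_sum YB f0m) size_flatten /shape -map_comp sumnE big_map.
  by rewrite big_enum; apply: eq_bigr => v _; rewrite /= size_nseq.
have cL v : count_mem v L = if v \in A then s v else 0.
  rewrite count_flatten -map_comp sumnE big_map big_enum /=.
  under eq_bigr do rewrite count_nseq /=.
  case: ifP => vA; first rewrite (bigD1 v) //= eqxx mul1n big1 ?addn0 //.
    by move=> i /andP[_ /negPf ->].
  by rewrite big1 // => i iA; case: eqP iA vA => [->->|].
have LA v : v \in L -> v \in A.
  by move=> vL; apply: contraLR vL => vA; rewrite -has_pred1 has_count cL (negPf vA).
have := @card_containing_demand _ A B d Y L set0 (d * #|Y|) YB LA.
rewrite cards0 add0n sL leqnn => /(_ isT hA d0); rewrite containing0; apply: leq_trans.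
rewrite leq_mul2r; apply/orP; right; apply: subset_leq_card; apply/subsetP => f.
move=> /matchingP[fO fm]; rewrite inE fO; apply/forallP => v.
rewrite cL; case: ifP => // vA; rewrite -(fm v vA).
by apply: subset_leq_card; apply/subsetP => y; rewrite !inE => /andP[-> ->].
Qed.

Lemma card_split_subsets (U Y : {set T}) a k :
  #|[set S : {set T} | [&& S \subset U, #|S| == k & #|S :&: Y| == a]]| <=
  'C(#|U :&: Y|, a) * 'C(#|U :\: Y|, k - a).
Proof.
rewrite -!cards_draws -cardsX -(card_in_imset (f := fun S : {set T} => (S :&: Y, S :\: Y))).
  apply: subset_leq_card; apply/subsetP => _ /imsetP[S + ->]; rewrite !inE /=.
  move=> /and3P[SU /eqP <- /eqP <-]; rewrite setSI ?setSD //= eqxx /=.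
  by rewrite -(cardsID Y S) addKn.
by move=> S S' _ _ [e1 e2]; rewrite -(setID S Y) e1 e2 setID.
Qed.

(** * Redistributing the elements of two rows *)

Section PairStep.
Local Open Scope ring_scope.
Variables (Y : {set T}) (v w : T) (a b : nat) (kappa : rat).
Hypotheses (vA : v \in A) (wA : w \in A) (vw : v != w).
Hypothesis hk : ('C(a + b, a) * 'C(2 * d - (a + b), d - a))%:R <= kappa * ('C(2 * d, d))%:R.

(** The value [kappa] on intersecting rows makes the average over every redistribution
    class at most [kappa], so that weights of disjoint pairs multiply. *)
Definition pair_weight f : rat :=
  if f v :&: f w == set0 then ((#|f v :&: Y| == a) && (#|f w :&: Y| == b))%:R else kappa.

(** Families are classed by all other rows and by the union [U] and the intersection [I] of the two
    rows; [W] is constant on a class. If [I] is nonempty the weight is constantly [kappa]. Otherwise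
    every split of [U] into two [d]-sets stays in the class, which gives at least ['C(2 * d, d)]
    members, while by [hk] few enough of them meet [Y] in [a] and [b] elements. *)
Lemma pair_weight_sum (W : {ffun T -> {set T}} -> rat) :
  (forall f, 0 <= W f) -> (forall f S1 S2, W (upd2 f v w S1 S2) = W f) ->
  \sum_(f in Om) W f * pair_weight f <= kappa * \sum_(f in Om) W f.
Proof.
move=> W0 WE; pose key f := (upd2 f v w set0 set0, f v :|: f w, f v :&: f w).
rewrite (partition_big key xpredT) //= [X in kappa * X](partition_big key xpredT) //=.
rewrite mulr_sumr; apply: ler_sum => -[[g U] I] _.
have [I0|I0] := eqVneq I set0; last first.
  rewrite mulr_sumr le_eqVlt; apply/orP; left; apply/eqP; apply: eq_bigr => f /andP[_ /eqP[_ _ fI]].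
  by rewrite /pair_weight fI (negPf I0) mulrC.
pose Fb := [set f in Om | key f == (g, U, I)].
have FbP f : f \in Fb -> [/\ f \in Om, upd2 f v w set0 set0 = g, f v :|: f w = U & f v :&: f w = set0].
  by rewrite inE => /andP[-> /eqP[-> -> ->]].
have -> : \sum_(f in Om | key f == (g, U, I)) W f = W g * #|Fb|%:R.
  rewrite (eq_bigr (fun=> W g)) => [|f /andP[_ /eqP[<- _ _]]]; last by rewrite WE.
  by rewrite sumr_const -[LHS]mulr_natr; congr (W g * _); congr (_%:R); apply: eq_card => f; rewrite [RHS]inE.
pose Mt := [set f in Fb | (#|f v :&: Y| == a) && (#|f w :&: Y| == b)].
have -> : \sum_(f in Om | key f == (g, U, I)) W f * pair_weight f = W g * #|Mt|%:R.
  rewrite -sum1_card natr_sum mulr_sumr [RHS]big_mkcond [LHS]big_mkcond; apply: eq_bigr => f _.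
  rewrite [f \in Mt]inE [f \in Fb]inE; case: ifP => //= /andP[_ /eqP[<- _ fI]].
  by rewrite /pair_weight fI I0 eqxx WE; case: (_ && _); rewrite ?mulr1 ?mulr0.
rewrite mulrCA ler_wpM2l //.
have [->|[f fM]] := set_0Vmem Mt.
  rewrite cards0 mulr_ge0 // -(ler_pM2r (x := ('C(2 * d, d))%:R)) ?mul0r; last first.
    by rewrite ltr0n bin_gt0; lia.
  by apply: le_trans hk; rewrite ler0n.
have [fF /andP[/eqP fa /eqP fb]] : f \in Fb /\ (#|f v :&: Y| == a) && (#|f w :&: Y| == b).
  by apply/andP; move: fM; rewrite inE.
have [fO fg fU f0] := FbP _ fF.
have [h1 h2 h3 h4] := row_familiesP _ _ _ _ fO.
have cU : #|U| = (2 * d)%N by rewrite -fU cardsU f0 cards0 subn0 !h3 // mul2n addnn.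
have UY : #|U :&: Y| = (a + b)%N.
  by rewrite -fU setIUl cardsU setIACA f0 set0I cards0 subn0 fa fb.
have UnY : #|U :\: Y| = (2 * d - (a + b))%N by rewrite -cU -(cardsID Y U) UY addKn.
have FbS f1 : f1 \in Fb -> f1 w = U :\: f1 v.
  move=> /FbP[_ _ <- /setP k]; apply/setP => x; have := k x; rewrite !inE.
  by case: (x \in f1 v); case: (x \in f1 w).
have cM : (#|Mt| <= 'C(a + b, a) * 'C(2 * d - (a + b), d - a))%N.
  rewrite -UnY -UY -(card_in_imset (f := fun f : {ffun T -> {set T}} => f v)).
    apply: leq_trans (card_split_subsets _ _ _ _).
    apply: subset_leq_card; apply/subsetP => _ /imsetP[f1 + ->].
    rewrite [f1 \in Mt]inE => /andP[/FbP[f1O _ <- _] /andP[k1 _]]; rewrite inE k1 subsetUl /=.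
    by have [_ _ -> //] := row_familiesP _ _ _ _ f1O; rewrite eqxx.
  move=> f1 f2; rewrite ![_ \in Mt]inE => /andP[k1 _] /andP[k2 _] e.
  have e' : f1 w = f2 w by rewrite (FbS _ k1) (FbS _ k2) e.
  have [_ g1 _ _] := FbP _ k1; have [_ g2 _ _] := FbP _ k2.
  rewrite -(upd2_id f1 v w) -(upd2_id f2 v w) e e'.
  by rewrite -(upd2_upd2 f1 v w set0 set0) g1 -g2 upd2_upd2.
have cF : ('C(2 * d, d) <= #|Fb|)%N.
  rewrite -cU -cards_draws -(card_in_imset (f := fun S => upd2 f v w S (U :\: S))).
    apply: subset_leq_card; apply/subsetP => _ /imsetP[S + ->]; rewrite [S \in _]inE => /andP[SU /eqP cS].
    rewrite inE; apply/andP; split.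
      apply: upd2_in => //; first by rewrite cardsD (setIidPr SU) cU cS; lia.
      move=> x; rewrite inE -fU; have /setP/(_ x) := f0; have := subsetP SU x.
      rewrite -fU !inE; case: (x \in S); case: (x \in f v); case: (x \in f w) => //= /(_ isT) //.
    rewrite /key upd2_upd2 fg upd2_1 upd2_2 // I0.
    rewrite -{1}(setIidPr SU) setID (_ : S :&: (U :\: S) = set0) //.
    by apply/setP => x; rewrite !inE; case: (x \in S).
  by move=> S1 S2 _ _ /ffunP/(_ v); rewrite !upd2_1.
apply: (@le_trans _ _ ('C(a + b, a) * 'C(2 * d - (a + b), d - a))%:R); first by rewrite ler_nat.
apply: le_trans hk _; rewrite ler_wpM2l ?ler_nat //.
have := le_trans (ler0n _ _) hk; rewrite pmulr_lge0 // ltr0n bin_gt0; lia.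
Qed.
End PairStep.
End Matching.

(** * Cyclic pairings of two sets *)

Section ShiftPairings.
Variables (T : finType) (P Q : {set T}).

(** Over the shifts [k < #|Q|], each [v] is paired with each element of [Q] once, which is what
    allows averaging over [k]. The default [v] of [nth] is not reached when [Q] is nonempty. *)
Definition shift_pairing k v := nth v (enum Q) ((index v (enum P) + k) %% #|Q|).

Lemma shift_pairing_in k v : 0 < #|Q| -> shift_pairing k v \in Q.
Proof. by move=> Q0; rewrite -mem_enum mem_nth // -cardE ltn_mod. Qed.

Lemma shift_pairing_inj k : #|P| <= #|Q| -> {in P &, injective (shift_pairing k)}.
Proof.
move=> PQ v w vP wP; have P0 : 0 < #|P| by apply/card_gt0P; exists v.
have Q0 := leq_trans P0 PQ.
have hv : index v (enum P) < #|Q| by apply: leq_trans PQ; rewrite cardE index_mem mem_enum.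
have hw : index w (enum P) < #|Q| by apply: leq_trans PQ; rewrite cardE index_mem mem_enum.
rewrite /shift_pairing (set_nth_default w) -?cardE ?ltn_mod // => /eqP.
rewrite nth_uniq ?enum_uniq -?cardE ?ltn_mod // eqn_modDr !modn_small // => /eqP e.
by rewrite -(nth_index v (s := enum P) (x := v)) ?mem_enum // e nth_index // mem_enum.
Qed.

Lemma shift_pairing_injk v : 0 < #|Q| ->
  injective (fun k : 'I_#|Q| => shift_pairing k v).
Proof.
move=> Q0 k l /eqP.
rewrite nth_uniq ?enum_uniq -?cardE ?ltn_mod // eqn_modDl !modn_small // => /eqP.
exact: val_inj.
Qed.

End ShiftPairings.

(** * Multiplying the gains of many pairs *)

Section PairProduct.
Variables (T : finType) (A B : {set T}) (d : nat).
Local Notation Om := (row_families A B d).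
Implicit Types (f : {ffun T -> {set T}}).
Variables (Y P Q : {set T}) (s : T -> nat) (kappa : T -> rat) (delta : rat).
Hypotheses (PA : P \subset A) (QA : Q \subset A) (PQ : [disjoint P & Q]).
Hypothesis PQle : #|P| <= #|Q|.
Hypothesis Q0 : 0 < #|Q|.
Local Open Scope ring_scope.
Hypothesis kappaP : forall v w, v \in P -> w \in Q ->
  ('C(s v + s w, s v) * 'C(2 * d - (s v + s w), d - s v))%:R <= kappa v * ('C(2 * d, d))%:R.
Hypothesis delta0 : 0 < delta.
Hypothesis delta1 : delta <= 1.
Hypothesis deltaP : forall v, v \in P -> delta <= kappa v.

(** One pair is peeled off at a time. The weights of the remaining pairs ignore the rows [v] and
    [tau v], because [tau] is injective on [P] and [P], [Q] are disjoint. *)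
Lemma pair_weight_prod (tau : T -> T) : (forall v, v \in P -> tau v \in Q) ->
  {in P &, injective tau} ->
  \sum_(f in Om) \prod_(v in P) pair_weight Y v (tau v) (s v) (s (tau v)) (kappa v) f
   <= (\prod_(v in P) kappa v) * #|Om|%:R.
Proof.
move=> tQ tI; rewrite -[X in _ <= X * _]big_enum /=.
under eq_bigr do rewrite -big_enum /=.
have : {subset enum P <= P} by move=> v; rewrite mem_enum.
elim: (enum P) (enum_uniq P) => [_ _|v l IH /= /andP[vl ul] lP].
  rewrite big_nil mul1r; under eq_bigr do rewrite big_nil.
  by rewrite sumr_const.
have vP : v \in P by apply: lP; rewrite inE eqxx.
have lP' : {subset l <= P} by move=> x xl; apply: lP; rewrite inE xl orbT.
have k0 x : x \in P -> 0 <= kappa x by move=> xP; apply: le_trans (ltW delta0) (deltaP xP).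
pose W f := \prod_(x <- l) pair_weight Y x (tau x) (s x) (s (tau x)) (kappa x) f.
under eq_bigr do rewrite big_cons mulrC.
rewrite big_cons -mulrA.
apply: le_trans (ler_wpM2l (k0 v vP) (IH ul lP')).
have disj x y : x \in P -> y \in Q -> x != y.
  by move=> xP yQ; apply: contraTneq yQ => <-; rewrite (disjointFr PQ).
apply: (@pair_weight_sum _ A B d Y v (tau v) (s v) (s (tau v)) (kappa v) _ _ _ _ W).
- exact: (subsetP PA).
- exact: (subsetP QA _ (tQ _ vP)).
- by apply: disj => //; apply: tQ.
- by apply: kappaP => //; apply: tQ.
- move=> f; rewrite /W big_seq; apply: prodr_ge0 => x /lP' xP; rewrite /pair_weight.
  by case: ifP; rewrite ?ler0n ?k0.
- move=> f S1 S2; rewrite /W big_seq [RHS]big_seq; apply: eq_bigr => x xl.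
  have xP := lP' _ xl; have xv : x != v by apply: contraNneq vl => <-.
  rewrite /pair_weight !upd2_other //.
  - by rewrite eq_sym; apply: disj vP (tQ _ xP).
  - by apply: contra_neq xv; apply: tI.
  - exact: disj xP (tQ _ vP).
Qed.

(** A row meets at most [d ^ 2] rows, itself included, so over all [#|Q|] shifts there are at most
    [#|P| * d ^ 2 <= #|Q| * d ^ 2] intersecting pairs. Some shift is no worse than the average. *)
Lemma few_shared_columns f : f \in Om -> exists k : 'I_#|Q|,
  (#|[set v in P | f v :&: f (shift_pairing P Q k v) != set0]| <= d ^ 2)%N.
Proof.
move=> fO; have [h1 h2 h3 h4] := row_familiesP _ _ _ _ fO.
apply/existsP; apply: contraT; rewrite negb_exists => /forallP hk.
have : (\sum_(k < #|Q|) (d ^ 2).+1 <=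
        \sum_(k < #|Q|) #|[set v in P | f v :&: f (shift_pairing P Q k v) != set0]|)%N.
  by apply: leq_sum => k _; have := hk k; rewrite -ltnNge.
rewrite sum_nat_const card_ord.
under eq_bigr do rewrite -sum1_card big_mkcond /=.
rewrite exchange_big /= (bigID [in P]) /= [X in (_ + X)%N]big1 ?addn0; last first.
  by move=> v /negPf vP; rewrite big1 // => k _; rewrite inE vP.
have bnd v : v \in P -> (\sum_(k < #|Q|)
    (if v \in [set v0 in P | f v0 :&: f (shift_pairing P Q k v0) != set0] then 1 else 0) <= d ^ 2)%N.
  move=> vP; rewrite -big_mkcond sum1_card /=.
  rewrite -(card_imset _ (@shift_pairing_injk _ P Q v Q0)).
  apply: (@leq_trans #|\bigcup_(x in f v) [set w | x \in f w]|).
    apply: subset_leq_card; apply/subsetP => _ /imsetP[k hk' ->].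
    have : v \in [set v0 in P | f v0 :&: f (shift_pairing P Q k v0) != set0] by exact: hk'.
    rewrite inE vP /= => /set0Pn[x].
    by rewrite inE => /andP[xv xw]; apply/bigcupP; exists x; rewrite ?inE.
  apply: leq_trans (leq_card_bigcup _ _) _.
  apply: (@leq_trans (\sum_(x in f v) d)%N); first by apply: leq_sum => x _; apply: card_col fO.
  by rewrite sum_nat_const h3 ?mulnn // (subsetP PA).
move=> h; have := leq_trans h (leq_sum _ bnd); rewrite sum_nat_const mulnS.
have := leq_mul PQle (leqnn (d ^ 2)); lia.
Qed.

(** For a matching family and a shift with at most [d ^ 2] intersecting pairs, disjoint pairs have
    weight 1 and the others weight at least [delta], so the product is at least [delta ^+ (d ^ 2)].
    The factor [#|Q|] pays for the choice of the shift. *)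
Lemma card_matching_pairs :
  delta ^+ (d ^ 2) * #|matching A B d Y s|%:R <=
    #|Q|%:R * ((\prod_(v in P) kappa v) * #|Om|%:R).
Proof.
pose bad (k : 'I_#|Q|) f := [set v in P | f v :&: f (shift_pairing P Q k v) != set0].
pose M k := [set f in matching A B d Y s | (#|bad k f| <= d ^ 2)%N].
have sub : matching A B d Y s \subset \bigcup_(k in [set: 'I_#|Q|]) M k.
  apply/subsetP => f fM; have [fO _] := matchingP _ _ _ _ _ _ fM.
  by have [k hk] := few_shared_columns fO; apply/bigcupP; exists k; rewrite ?in_setT // [f \in M k]in_set fM.
have := leq_trans (subset_leq_card sub) (leq_card_bigcup _ _).
rewrite -(ler_nat rat) natr_sum => h.
apply: le_trans (ler_wpM2l (exprn_ge0 _ (ltW delta0)) h) _.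
rewrite mulr_sumr -[X in X%:R * _]card_ord mulr_natl -[X in _ *+ X]cardsT -sumr_const.
apply: ler_sum => k _.
have tI := shift_pairing_inj (k := k) PQle.
apply: le_trans (pair_weight_prod (fun v _ => shift_pairing_in P k v Q0) tI).
have k0 x : x \in P -> 0 <= kappa x by move=> xP; apply: le_trans (ltW delta0) (deltaP xP).
have pw0 f x : x \in P -> 0 <= pair_weight Y x (shift_pairing P Q k x) (s x)
    (s (shift_pairing P Q k x)) (kappa x) f.
  by move=> xP; rewrite /pair_weight; case: ifP; rewrite ?ler0n ?k0.
rewrite mulr_natr -sumr_const [X in _ <= X](bigID [in M k]) /=.
rewrite ler_wpDr ?sumr_ge0 // => [f _|]; first by apply: prodr_ge0 => x; apply: pw0.
rewrite [X in _ <= X](eq_bigl [in M k]) => [|f]; last first.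
  by rewrite andb_idl // [f \in M k]in_set => /andP[/matchingP[]].
apply: ler_sum => f.
rewrite [f \in M k]in_set => /andP[/matchingP[fO fm] fb].
apply: le_trans (ler_wiXn2l (ltW delta0) delta1 fb) _.
rewrite -prodr_const [X in X <= _]big_mkcond [X in _ <= X]big_mkcond /=.
apply: ler_prod => x _; rewrite inE; case: (boolP (x \in P)) => xP /=; last by rewrite ?ler01 ?lexx.
rewrite /pair_weight; case: eqP => _ /=; last by rewrite ltW //= deltaP.
have tA : shift_pairing P Q k x \in A by apply: (subsetP QA); apply: shift_pairing_in.
by rewrite (fm x) ?(subsetP PA) // fm // !eqxx lexx.
Qed.
End PairProduct.

(** * Hypergeometric estimates *)

(** Divided by ['C(2 * d, d)]: the probability that a random [d]-subset of a [2d]-set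
    meets a given [u]-set in [j] points. *)
Definition hyperg d u j := 'C(u, j) * 'C(2 * d - u, d - j).

(** Corresponds to replacing a [d]-subset of the [2d]-set by its complement. *)
Lemma hyperg_sym d u j : j <= u -> j <= d -> u <= d + j -> hyperg d u (u - j) = hyperg d u j.
Proof.
move=> ju jd udj; rewrite /hyperg bin_sub //; congr (_ * _).
have h : d - j <= 2 * d - u by lia.
by rewrite -(bin_sub h); congr ('C(_, _)); lia.
Qed.

Lemma hyperg_ratio d u j : j < u -> j < d -> u <= d + j.+1 ->
  hyperg d u j * ((u - j) * (d - j)) = hyperg d u j.+1 * (j.+1 * (d + j.+1 - u)).
Proof.
move=> ju jd udj; rewrite /hyperg.
have e1 := mul_bin_left u j.
have e2 := mul_bin_left (2 * d - u) (d - j.+1).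
have e3 : (d - j.+1).+1 = d - j by lia.
have e4 : 2 * d - u - (d - j.+1) = d + j.+1 - u by lia.
rewrite e3 e4 in e2.
transitivity (((u - j) * 'C(u, j)) * ((d - j) * 'C(2 * d - u, d - j))); first by ring.
by rewrite -e1 e2; ring.
Qed.

(** These terms are a part of Vandermonde's sum for ['C(2 * d, d)]. *)
Lemma hyperg_interval d u lo k : u <= 2 * d -> lo + k <= d.+1 ->
  \sum_(i < k) hyperg d u (lo + i) <= 'C(2 * d, d).
Proof.
move=> ud lk; have -> : 2 * d = u + (2 * d - u) by lia.
rewrite -binomial.Vandermonde -(big_mkord xpredT (fun j => 'C(u, j) * 'C(2 * d - u, d - j))).
rewrite (big_cat_nat (n := lo)) //=; last by lia.
rewrite (big_cat_nat (m := lo) (n := lo + k)) //=; last by lia.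
have -> : \sum_(i < k) hyperg d u (lo + i) =
          \sum_(lo <= j < lo + k) 'C(u, j) * 'C(2 * d - u, d - j).
  rewrite -{2}(add0n lo) big_addn addKn big_mkord.
  by apply: eq_bigr => i _; rewrite /hyperg addnC.
by rewrite addnCA leq_addr.
Qed.

(** In [hyperg_ratio] both factors on the left dominate those on the right once [2 * j + 1 <= u]. *)
Lemma hyperg_incr d u j : j < d -> u <= d + j.+1 -> 2 * j.+1 <= u.+1 ->
  hyperg d u j <= hyperg d u j.+1.
Proof.
move=> jd udj ju; have e := hyperg_ratio (_ : j < u) jd udj.
have pos : 0 < (u - j) * (d - j) by rewrite muln_gt0; lia.
rewrite -(leq_pmul2r pos) e; last by lia.
by rewrite leq_mul2l; apply/orP; right; apply: leq_mul; lia.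
Qed.

(** Terms increase from [a] to the middle of [a + b]; a [j] beyond the middle is reflected into the
    first half. *)
Lemma hyperg_between d a b j : a <= b -> b <= d -> a <= j <= b ->
  hyperg d (a + b) a <= hyperg d (a + b) j.
Proof.
move=> ab bd; have low i : 2 * (a + i) <= a + b -> hyperg d (a + b) a <= hyperg d (a + b) (a + i).
  elim: i => [|i IH] h; first by rewrite addn0.
  by apply: leq_trans (IH _) _; [lia | rewrite addnS hyperg_incr; lia].
move=> /andP[aj jb]; have [h|h] := leqP (2 * j) (a + b).
  by have := low (j - a); rewrite subnKC //; apply.
have -> : hyperg d (a + b) j = hyperg d (a + b) (a + b - j) by rewrite hyperg_sym; lia.
have := low (b - j); have -> : a + (b - j) = a + b - j by lia.
by apply; lia.
Qed.

(** Raising [a] by one multiplies ['C(2 * d - a, d - a)] by [(d - a) / (2 * d - a)], which is at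
    most one half. *)
Lemma hyperg_half d a : a <= d -> hyperg d a a * 2 ^ a <= 'C(2 * d, d).
Proof.
move=> ad; rewrite /hyperg binn mul1n; elim: a ad => [|a IH] ad.
  by rewrite !subn0 muln1.
apply: leq_trans (IH (ltnW ad)); rewrite expnS mulnA leq_mul2r; apply/orP; right.
have e := mul_bin_diag (2 * d - a) (d - a.+1).
have e1 : (2 * d - a).-1 = 2 * d - a.+1 by lia.
have e2 : (d - a.+1).+1 = d - a by lia.
rewrite e1 e2 in e.
have p : 0 < 2 * d - a by lia.
rewrite -(leq_pmul2l p) mulnA e mulnAC leq_mul2r; apply/orP; right; lia.
Qed.

(** The [b - a + 1] terms from [a] to [b] all dominate the one at [a]. *)
Lemma hyperg_wide d a b : a <= b -> b <= d ->
  (b - a).+1 * hyperg d (a + b) a <= 'C(2 * d, d).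
Proof.
move=> ab bd; apply: leq_trans (@hyperg_interval d (a + b) a (b - a).+1 _ _); [|lia..].
rewrite -{1}[(b - a).+1]card_ord -sum_nat_const; apply: leq_sum => i _.
by apply: hyperg_between => //; have := ltn_ord i; lia.
Qed.

(** For distinct [a] and [b] two terms already suffice. For [a = b] the neighbours at [a - 1] and
    [a + 1] are equal and at least a quarter of the middle term, so the three add up to at least 3/2
    of it. *)
Lemma hyperg_nontrivial d a b : a <= d -> b <= d -> 0 < a + b < 2 * d ->
  3 * hyperg d (a + b) a <= 2 * 'C(2 * d, d).
Proof.
wlog ab : a b / a <= b => [W ad bd h|].
  case: (leqP a b) => ab; first exact: W.
  have := W b a (ltnW ab) bd ad; rewrite [b + a]addnC.
  have -> : hyperg d (a + b) b = hyperg d (a + b) a by rewrite -[in RHS](@hyperg_sym d (a + b) a) ?addKn //; lia.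
  exact.
move=> ad bd h; have hw := hyperg_wide ab bd.
have [e|ne] := eqVneq a b; last by have := leq_mul (_ : 2 <= (b - a).+1) (leqnn (hyperg d (a + b) a)); lia.
rewrite -e in h hw *.
have a0 : 0 < a by lia.
have := @hyperg_interval d (a + a) a.-1 3; rewrite !big_ord_recr big_ord0 /= add0n addn0.
rewrite addn1 addn2 prednK // => hs.
have r1 := @hyperg_ratio d (a + a) a.-1; rewrite prednK // in r1.
have r2 : hyperg d (a + a) a.-1 = hyperg d (a + a) a.+1.
  have -> : a.+1 = a + a - a.-1 by lia.
  by rewrite hyperg_sym; lia.
have {r1} := r1 ltac:(lia) ltac:(lia) ltac:(lia).
have := hs ltac:(lia) ltac:(lia).
have e1 : a + a - a.-1 = a.+1 by lia.
have e2 : d - a.-1 = (d - a).+1 by lia.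
have e3 : d + a - (a + a) = d - a by lia.
rewrite -r2 e1 e2 e3.
move: (hyperg d (a + a) a) (hyperg d (a + a) a.-1) => x y h1 h2.
have : x <= 4 * y; last by lia.
have p : 0 < a * (d - a) by rewrite muln_gt0; lia.
rewrite -(leq_pmul2r p) -h2 -mulnA [4 * _]mulnC -mulnA leq_mul2l; apply/orP; right.
rewrite (_ : a * (d - a) * 4 = (2 * a) * (2 * (d - a))); last by ring.
by apply: leq_mul; lia.
Qed.

(** For the ratio of consecutive terms near the mode: adding at most [c] to two large factors
    multiplies their product by at most [L / (L - 1)]. *)
Lemma mul_shift_le L c p q e : e <= c -> 4 * (L * c) <= p -> 4 * (L * c) <= q ->
  L.-1 * ((p + e) * (q + e)) <= L * (p * q).
Proof.
move=> ec hp hq; case: L hp hq => [|L] //= hp hq.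
have h1 : 4 * (L.+1 * e * p) <= q * p.
  by rewrite mulnA leq_mul2r; apply/orP; right; apply: leq_trans hq; rewrite leq_mul2l leq_mul2l ec !orbT.
have h2 : 4 * (L.+1 * e * q) <= p * q.
  by rewrite mulnA leq_mul2r; apply/orP; right; apply: leq_trans hp; rewrite leq_mul2l leq_mul2l ec !orbT.
have h3 : L.+1 * e * e <= L.+1 * e * p.
  rewrite leq_mul2l; apply/orP; right; apply: leq_trans ec (leq_trans _ hp).
  by rewrite mulnA leq_pmull.
have e1 : L * ((p + e) * (q + e)) = L * (p * q) + (L * e * p + L * e * q + L * e * e) by ring.
have m x : L * e * x <= L.+1 * e * x by rewrite leq_mul2r leq_mul2r leqnSn !orbT.
rewrite e1 [L.+1 * (p * q)]mulSn; have := m p; have := m q; have := m e.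
move: h1 h2 h3; rewrite (mulnC q p).
move: (L.+1 * e * p) (L.+1 * e * q) (L.+1 * e * e) (L * e * p) (L * e * q) (L * e * e) (p * q) (L * (p * q)).
by move=> *; lia.
Qed.

(** Each step down from [a] keeps at least the fraction [1 - 1 / L], and
    [(1 - 1 / L) ^ i >= 1 - i / L] by Bernoulli's inequality. *)
Lemma hyperg_tail d a b L i : a <= b -> b < a + L -> b <= d -> i <= L -> i <= a ->
  4 * (L * (3 * L + 1)) + L <= a -> 4 * (L * (3 * L + 1)) + L <= d - b ->
  (L - i) * hyperg d (a + b) a <= L * hyperg d (a + b) (a - i).
Proof.
move=> ab bL bd; have [R eR] : exists R, 4 * (L * (3 * L + 1)) = R by eexists.
rewrite eR => + + ha hb; elim: i => [|i IH] iL ia; first by rewrite !subn0.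
have L0 : 0 < L by lia.
pose j := a - i.+1.
have ej : a - i = j.+1 by rewrite /j; lia.
have {}IH := IH (ltnW iL) (ltnW ia); rewrite ej in IH.
have r := @hyperg_ratio d (a + b) j; rewrite -/j.
have {}r := r ltac:(clear eR; rewrite /j; lia) ltac:(clear eR; rewrite /j; lia) ltac:(clear eR; rewrite /j; lia).
pose e := a + b - j - j.+1.
have e1 : a + b - j = j.+1 + e by clear eR; rewrite /e /j; lia.
have e2 : d - j = (d + j.+1 - (a + b)) + e by clear eR; rewrite /e /j; lia.
have hp : R <= j.+1 by clear eR; rewrite /j; lia.
have hq : R <= d + j.+1 - (a + b) by clear eR; rewrite /j; lia.
have he : e <= 3 * L + 1 by clear eR; rewrite /e /j; lia.
rewrite -eR in hp hq; have ms := mul_shift_le he hp hq.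
rewrite -e1 -e2 in ms.
have pos : 0 < (a + b - j) * (d - j) by clear eR; rewrite muln_gt0 /j; lia.
have st : L.-1 * hyperg d (a + b) j.+1 <= L * hyperg d (a + b) j.
  rewrite -(leq_pmul2r pos) -[X in _ <= X]mulnA r.
  have := leq_mul (leqnn (hyperg d (a + b) j.+1)) ms.
  by rewrite -[X in _ -> X <= _]mulnA [X in _ -> X <= _]mulnCA [X in _ -> _ <= X]mulnCA.
rewrite -(leq_pmul2l L0).
have h1 : L * (L - i.+1) <= L.-1 * (L - i).
  have -> : L - i = (L - i.+1).+1 by rewrite -subSn.
  by rewrite -[X in X * _ <= _](prednK L0) mulSn mulnS leq_add2r -ltnS (prednK L0) ltn_subrL.
have h2 := leq_mul h1 (leqnn (hyperg d (a + b) a)).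
have h3 := leq_mul (leqnn L.-1) IH.
have h4 := leq_mul (leqnn L) st.
rewrite mulnA; apply: leq_trans h2 _; rewrite -mulnA; apply: leq_trans h3 _.
by rewrite mulnCA.
Qed.

(** Either [a] and [b] are far apart, and the values between them are all at least as
    large as the one at [a], or [a] is near the mode and its neighbours are comparable. *)
Lemma hyperg_concentration K : exists t, forall d a b, a <= d -> b <= d ->
  t <= a + b -> a + b + t <= 2 * d -> K * hyperg d (a + b) a <= 'C(2 * d, d).
Proof.
case: K => [|K0]; first by exists 0.
(* With [L = 4 * K], going down [2 * K] steps keeps at least half of the value at [a]. [R] is the
   threshold of [hyperg_tail], and [2 * R + L] ensures it for both [a] and [d - b] when
   [b - a < L]. *)
set K := K0.+1; pose L := 4 * K; pose R := 4 * (L * (3 * L + 1)) + L.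
exists (2 * R + L) => d a b; wlog ab : a b / a <= b => [W ad bd h1 h2|].
  case: (leqP a b) => ab; first exact: W.
  have := W b a (ltnW ab) bd ad; rewrite [b + a]addnC.
  have -> : hyperg d (a + b) b = hyperg d (a + b) a.
    by rewrite -[in RHS](@hyperg_sym d (a + b) a) ?addKn //; lia.
  exact.
move=> ad bd h1 h2; have [wide|narrow] := leqP L (b - a).
  apply: leq_trans (hyperg_wide ab bd); rewrite leq_mul2r; apply/orP; right.
  by rewrite /L in wide; lia.
have aR : R <= a by lia.
have bR : R <= d - b by lia.
have K2 : 2 * K <= L by rewrite /L; lia.
have RL : L <= R by rewrite /R; lia.
have hI := @hyperg_interval d (a + b) (a - (2 * K)) (2 * K).+1 ltac:(lia) ltac:(lia).
have : (2 * K).+1 * hyperg d (a + b) a <= 2 * 'C(2 * d, d).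
  apply: leq_trans (leq_mul (leqnn 2) hI).
  rewrite big_distrr /= -{1}[(2 * K).+1]card_ord -sum_nat_const; apply: leq_sum => i _.
  have il := ltn_ord i; have e : a - 2 * K + i = a - (2 * K - i) by lia.
  have := @hyperg_tail d a b L (2 * K - i) ab ltac:(lia) bd ltac:(lia) ltac:(lia) aR bR.
  rewrite e; move: (hyperg _ _ a) (hyperg _ _ (a - _)) => x y h.
  have L2 : 0 < 2 * K by rewrite /K; lia.
  rewrite -(leq_pmul2l L2); have -> : 2 * K * (2 * y) = L * y by rewrite /L; ring.
  apply: leq_trans h; rewrite leq_mul2r; apply/orP; right; lia.
by move: (hyperg _ _ _) => x; rewrite mulSn -mulnA; lia.
Qed.

(** * Elementary bounds on powers and binomials *)

(** With [w = c * (k + 1)] and [z = n %/ w], one has [n <= w * (z + 1)] and [C * w ^ k <= z + 1], so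
    the left side is at most [(z + 1) ^ (k + 1) <= 2 ^ (z * (k + 1))]. *)
Lemma exp2_dominates C k c : 0 < c ->
  exists N, forall n, N <= n -> C * n ^ k <= 2 ^ (n %/ c).
Proof.
move=> c0; exists (c * k.+1 * (C * (c * k.+1) ^ k)) => n hn.
set w := c * k.+1 in hn; have w0 : 0 < w by rewrite muln_gt0 c0.
pose z := n %/ w; have nz : n <= w * z.+1 by rewrite mulnC ltnW // -ltn_divLR.
have Cz : C * w ^ k <= z.+1.
  by rewrite leqW // /z leq_divRL // mulnC.
apply: (@leq_trans (z.+1 ^ k.+1)).
  apply: leq_trans (leq_mul (leqnn C) (_ : _ <= (w * z.+1) ^ k)) _.
    by case: (k) => // k'; rewrite leq_exp2r.
  by rewrite expnMn mulnA expnS leq_mul2r Cz orbT.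
apply: (@leq_trans ((2 ^ z) ^ k.+1)); first by rewrite leq_exp2r // ltn_expl.
by rewrite -expnM leq_exp2l // leq_divRL // -mulnA [k.+1 * c]mulnC leq_divM.
Qed.

Lemma bin_le_exp2 n m : 'C(n, m) <= 2 ^ n.
Proof.
have [nm|mn] := ltnP n m; first by rewrite bin_small.
rewrite -[2]/(1 + 1) expnDn (bigD1 (Ordinal (mn : m < n.+1))) //= !exp1n !muln1.
exact: leq_addr.
Qed.

(** The usual bound [(4 * n / m) ^ m] on the binomial, from
    [m ^ m <= (2 * m) ^_ m = 'C(2 * m, m) * m]! <= 4 ^ m * m[!]. *)
Lemma bin_mul_exp n m : 'C(n, m) * m ^ m <= (4 * n) ^ m.
Proof.
have h1 : m ^ m <= 4 ^ m * m`!.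
  have h : m ^ m <= (2 * m) ^_ m.
    rewrite ffact_prod -{2}(card_ord m) -prod_nat_const; apply: leq_prod => i _.
    by have := ltn_ord i; lia.
  apply: leq_trans h _; rewrite -bin_ffact leq_mul2r; apply/orP; right.
  by rewrite -[4]/(2 ^ 2) -expnM bin_le_exp2.
have h2 : n ^_ m <= n ^ m.
  rewrite ffact_prod -[in X in _ <= X](card_ord m) -prod_nat_const.
  by apply: leq_prod => i _; apply: leq_subr.
apply: leq_trans (leq_mul (leqnn _) h1) _.
by rewrite mulnCA bin_ffact expnMn leq_mul2l h2 orbT.
Qed.

Lemma exists_subset_card (T : finType) (S : {set T}) p : p <= #|S| ->
  exists2 P : {set T}, P \subset S & #|P| = p.
Proof.
move=> pS; have us : uniq (take p (enum S)) by rewrite take_uniq ?enum_uniq.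
exists [set x in take p (enum S)].
  by apply/subsetP => x; rewrite inE => /mem_take; rewrite mem_enum.
rewrite cardsE (card_uniqP us) size_take -cardE.
by case: ltngtP pS => // ->.
Qed.

Lemma leq_sq_exp4 m : m ^ 2 <= 4 ^ m.
Proof. by rewrite -[4]/(2 ^ 2) -expnM mulnC expnM leq_exp2r // ltnW // ltn_expl. Qed.

Lemma geometric_estimate (x y : rat) k m : (0 <= y -> 0 <= x -> x <= 4%:R^-1 ->
  y ^+ 2 * 4%:R <= 4%:R ^+ k -> (y ^+ m) ^+ 2 * x ^+ (k * m) <= 4%:R^-1 ^+ m)%R.
Proof.
move=> y0 x0 x4 hy.
have p4 : (0 < 4%:R ^+ k :> rat)%R by rewrite exprn_gt0.
have y20 : (0 <= y ^+ 2)%R by rewrite exprn_ge0.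
rewrite exprAC exprM -exprMn; apply: lerXn2r.
- by rewrite nnegrE mulr_ge0 ?exprn_ge0.
- by rewrite nnegrE invr_ge0 ler0n.
apply: (@le_trans _ _ (y ^+ 2 * 4%:R^-1 ^+ k)%R).
  by apply: ler_wpM2l => //; apply: lerXn2r; rewrite ?nnegrE ?invr_ge0 ?ler0n.
by rewrite exprVn ler_pdivrMr // ler_pdivlMl // mulrC.
Qed.

(** Put [x = 2 * d * m / n <= 1 / 4]; then [M <= x ^ (d * m) * O] and [C <= (4 * n / m) ^ m], where
    [4 * n / m * x = 8 * d] no longer depends on [n]. *)
Lemma small_set_estimate n m d C M O : 0 < n -> 0 < m -> 4 < d -> 8 * (d * m) <= n ->
  C * m ^ m <= (4 * n) ^ m -> M * n ^ (d * m) <= (2 * d * m) ^ (d * m) * O ->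
  (8 * d) ^ 2 * 4 <= 4 ^ (d - 4) -> n ^ 2 * (C ^ 2 * M) <= 4 * d ^ 2 * O.
Proof.
move=> n0 m0 d4 hx hb hM hd4; have hm4 := leq_sq_exp4 m.
have d0 : 0 < d by apply: ltn_trans d4.
(* Budget of the [d * m] factors [x]: [2 * m] cancel [C ^ 2], two cancel [n ^ 2], [(d - 4) * m]
   yield the decay [4 ^ - m] that absorbs [m ^ 2], and the rest is bounded by 1. *)
have e2 : d * m = m * 2 + (2 + ((d - 4) * m + (m - 1) * 2)).
  rewrite -{1}(subnK (ltnW d4)) mulnDl; clear -m0; move: ((d - 4) * m) => w; lia.
move: hx hM hb hd4 hm4; rewrite -!(ler_nat rat) !natrM !natrX !natrM -!expr2.
have nR : (0 < n%:R :> rat)%R by rewrite ltr0n.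
have mR : (0 < m%:R :> rat)%R by rewrite ltr0n.
have dR : (0 < d%:R :> rat)%R by rewrite ltr0n.
have M0 : (0 <= M%:R :> rat)%R by rewrite ler0n.
have O0 : (0 <= O%:R :> rat)%R by rewrite ler0n.
have C0 : (0 <= C%:R :> rat)%R by rewrite ler0n.
move: (n%:R)%R (m%:R)%R (d%:R)%R (M%:R)%R (O%:R)%R (C%:R)%R nR mR dR M0 O0 C0
  => N m' d' M' O' C' nR mR dR M0 O0 C0 hx hM hb hd4 hm4.
set x := ((2%:R * d' * m') / N)%R.
have x0 : (0 <= x)%R by rewrite /x divr_ge0 ?mulr_ge0 ?ler0n // ltW.
have x4 : (x <= 4%:R^-1)%R by rewrite /x ler_pdivrMr //; clear -hx; lra.
have hM' : (M' <= x ^+ (d * m) * O')%R.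
  by rewrite /x expr_div_n mulrAC ler_pdivlMr // exprn_gt0.
have hC' : (C' <= (4%:R * N / m') ^+ m)%R.
  by rewrite expr_div_n ler_pdivlMr // exprn_gt0.
have e1 : (4%:R * N / m' * x = 8%:R * d')%R by rewrite /x; field; rewrite !gt_eqF.
have le1 : (N ^+ 2 * (C' ^+ 2 * M') <= N ^+ 2 * (((4%:R * N / m') ^+ m) ^+ 2 * (x ^+ (d * m) * O')))%R.
  apply: ler_wpM2l; first by rewrite exprn_ge0 // ltW.
  apply: ler_pM => //; first by rewrite exprn_ge0.
  by apply: lerXn2r; rewrite ?nnegrE // (le_trans C0).
apply: le_trans le1 _.
have e3 : (((4%:R * N / m') ^+ m) ^+ 2 * x ^+ (d * m) =
   ((8%:R * d') ^+ m) ^+ 2 * (x ^+ 2 * (x ^+ ((d - 4) * m) * x ^+ ((m - 1) * 2))))%R.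
  by rewrite e2 !exprD exprM [LHS]mulrA -!exprMn e1 exprM.
rewrite [X in (_ * X <= _)%R]mulrA e3.
have hd5 : (((8%:R * d') ^+ m) ^+ 2 * x ^+ ((d - 4) * m) <= (4%:R^-1) ^+ m)%R.
  by apply: geometric_estimate => //; apply: mulr_ge0 => //; apply: ltW.
have x1 : (x ^+ ((m - 1) * 2) <= 1)%R by rewrite exprn_ile1 // (le_trans x4).
have Nx : (N * x = 2%:R * d' * m')%R by rewrite /x; field; rewrite gt_eqF.
have e5 (u v w z : rat) : (N ^+ 2 * (u * (x ^+ 2 * (v * w)) * z) = (N * x) ^+ 2 * ((u * v) * w) * z)%R by ring.
rewrite e5 Nx; apply: ler_wpM2r => //.
have z0 : (0 <= (2%:R * d' * m') ^+ 2)%R by apply: sqr_ge0.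
apply: (@le_trans _ _ ((2%:R * d' * m') ^+ 2 * (4%:R^-1) ^+ m)%R).
  apply: ler_wpM2l => //; rewrite -[X in (_ <= X)%R]mulr1; apply: ler_pM => //.
    by apply: mulr_ge0; [apply: sqr_ge0 | apply: exprn_ge0].
  exact: exprn_ge0.
have p4 : (0 < 4%:R ^+ m :> rat)%R by rewrite exprn_gt0.
rewrite exprVn ler_pdivrMr // !exprMn -mulrA -[X in (_ <= X)%R]mulrA.
apply: ler_pM => //; first by apply: mulr_ge0; apply: sqr_ge0.
by apply: ler_wpM2l => //; apply: sqr_ge0.
Qed.

(** * Small sets, by switching *)

Section Regimes.
Variables (T : finType) (A B Y : {set T}) (d n m : nat) (s : T -> nat).
Hypotheses (cA : #|A| = n) (cY : #|Y| = m) (YB : Y \subset B).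
Hypotheses (m0 : 0 < m) (mn : 2 * m <= n).
Hypothesis (hd : 2 * (32 * d) ^ 2 <= 2 ^ d).
Hypothesis (d4 : 4 < d).
Local Notation Om := (row_families A B d).
Local Notation M := (matching A B d Y s).

Let n0 : 0 < n. Proof. by clear hd; lia. Qed.
Let d0 : 0 < d. Proof. by clear hd; lia. Qed.

Lemma few_matching_small : 8 * (d * m) <= n -> 8 * d <= n ->
  n ^ 2 * ('C(n, m) ^ 2 * #|M|) <= 4 * d ^ 2 * #|Om|.
Proof.
move=> hm hn.
have hA : 2 * (d * #|Y| + 2 * d ^ 2) <= #|A| * d.
    rewrite cA cY -mulnn.
  have h1 : n <= n * d by rewrite leq_pmulr.
  by have h2 := leq_mul hn (leqnn d); lia.
have := card_matching_small s YB d0 hA; rewrite cA cY => hM.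
have hd4 : (8 * d) ^ 2 * 4 <= 4 ^ (d - 4).
  have e : 2 ^ d = 16 * 2 ^ (d - 4) by rewrite -[16]/(2 ^ 4) -expnD subnKC // ltnW.
  have y2 : 2 <= 2 ^ (d - 4) by rewrite -{1}(expn1 2) leq_exp2l // subn_gt0.
  have e' : 4 ^ (d - 4) = 2 ^ (d - 4) * 2 ^ (d - 4) by rewrite -expnMn.
  rewrite e'; move: hd; rewrite e !expnMn; move: y2; clear; move: (d ^ 2) (2 ^ (d - 4)) => x y y2.
  rewrite -![_ ^ 2]mulnn => h; apply: (@leq_trans (2 * y)); last by rewrite leq_mul2r y2 orbT.
  by lia.
apply: small_set_estimate n0 m0 d4 hm (bin_mul_exp n m) hM hd4.
Qed.

End Regimes.

(** * Larger sets, by pairing *)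

(** The case of [card_matching_pairs] where [kappa] and [delta] are both [p / q], cleared of
    denominators. *)
Lemma card_matching_pairs_const (T : finType) (A B Y P Q : {set T}) d (s : T -> nat) p q :
  P \subset A -> Q \subset A -> [disjoint P & Q] -> #|P| <= #|Q| -> 0 < #|Q| ->
  0 < p <= q ->
  (forall v w, v \in P -> w \in Q -> q * hyperg d (s v + s w) (s v) <= p * 'C(2 * d, d)) ->
  p ^ (d ^ 2) * q ^ #|P| * #|matching A B d Y s| <=
    #|Q| * p ^ #|P| * q ^ (d ^ 2) * #|row_families A B d|.
Proof.
move=> PA QA PQ PQle Q0 /andP[p0 pq] hk.
have q0 : 0 < q by apply: leq_trans pq.
have qR : (0 < q%:R :> rat)%R by rewrite ltr0n.
have pR : (0 < p%:R :> rat)%R by rewrite ltr0n.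
have := @card_matching_pairs T A B d Y P Q s (fun=> (p%:R / q%:R)%R) (p%:R / q%:R)%R
  PA QA PQ PQle Q0.
rewrite prodr_const !expr_div_n => h.
have {}h := h _ (divr_gt0 pR qR) _ _.
rewrite -(ler_nat rat) !natrM !natrX.
rewrite -(ler_pM2r (x := ((q%:R ^+ (d ^ 2))^-1 * (q%:R ^+ #|P|)^-1)%R)); last first.
  by rewrite mulr_gt0 // invr_gt0 exprn_gt0.
have qn k : (q%:R ^+ k != 0 :> rat)%R by rewrite expf_neq0 // gt_eqF.
have -> : (p%:R ^+ (d ^ 2) * q%:R ^+ #|P| * #|matching A B d Y s|%:R *
   ((q%:R ^+ (d ^ 2))^-1 * (q%:R ^+ #|P|)^-1) =
   p%:R ^+ (d ^ 2) / q%:R ^+ (d ^ 2) * #|matching A B d Y s|%:R :> rat)%R by field; rewrite !qn.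
have -> : (#|Q|%:R * p%:R ^+ #|P| * q%:R ^+ (d ^ 2) * #|row_families A B d|%:R *
   ((q%:R ^+ (d ^ 2))^-1 * (q%:R ^+ #|P|)^-1) =
   #|Q|%:R * (p%:R ^+ #|P| / q%:R ^+ #|P| * #|row_families A B d|%:R) :> rat)%R by field; rewrite !qn.
apply: h => // [v w vP wQ|]; last by rewrite ler_pdivrMr // mul1r ler_nat.
by rewrite mulrAC ler_pdivlMr // -!natrM ler_nat mulnC; apply: hk.
Qed.

Section Regimes.
Variables (T : finType) (A B Y : {set T}) (d n m : nat) (s : T -> nat).
Hypotheses (cA : #|A| = n) (cY : #|Y| = m) (YB : Y \subset B).
Hypotheses (m0 : 0 < m) (mn : 2 * m <= n).
Hypothesis (hd : 2 * (32 * d) ^ 2 <= 2 ^ d).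
Hypothesis (d4 : 4 < d).
Local Notation Om := (row_families A B d).
Local Notation M := (matching A B d Y s).

Let n0 : 0 < n. Proof. by clear hd; lia. Qed.
Let d0 : 0 < d. Proof. by clear hd; lia. Qed.

(** Each [v] with [s v > 0] is paired with a zero of [s], which gains [2 ^ - s v] by [hyperg_half];
    by [matching_sum] the total gain is [2 ^ - (d * m)]. As [n <= 8 * d * m], the choices number at
    most [(32 * d) ^ (2 * m)], and [hd] leaves a factor [2 ^ m] to spare. *)
Lemma few_matching_sparse : #|[set v in A | 0 < s v]| <= #|[set v in A | s v == 0]| ->
  n <= 8 * (d * m) ->
  'C(n, m) ^ 2 * #|M| * 2 ^ (n %/ (8 * d)) <= n * 2 ^ (d * d ^ 2) * #|Om|.
Proof.
set P := [set v in A | 0 < s v]; set Q := [set v in A | s v == 0] => PQle hm.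
have [->|[f fM]] := set_0Vmem M; first by rewrite cards0 muln0 mul0n.
have QA : Q \subset A by apply/subsetP => v; rewrite inE => /andP[].
have PA : P \subset A by apply/subsetP => v; rewrite inE => /andP[].
have PQ : [disjoint P & Q].
  rewrite -setI_eq0; apply/eqP/setP => v; rewrite !inE.
  by case: (v \in A) => //=; case: (s v).
have Q0 : 0 < #|Q|.
  have : A \subset P :|: Q.
    by apply/subsetP => v vA; rewrite !inE vA /=; case: (s v).
  move/subset_leq_card; rewrite cA; have := (leq_card_setU P Q).1; lia.
have tR k : (0 < 2%:R ^+ k :> rat)%R by rewrite exprn_gt0.
have sd v : v \in P -> s v <= d by move=> /(subsetP PA); apply: matching_le fM.
have := @card_matching_pairs T A B d Y P Q s (fun v => (2%:R ^+ s v)^-1)%R ((2%:R ^+ d)^-1)%R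
  PA QA PQ PQle Q0.
have -> : (\prod_(v in P) (2%:R ^+ s v)^-1 = (2%:R ^+ (d * m))^-1 :> rat)%R.
  rewrite prodfV prodrXr; congr (_ ^+ _)^-1%R; rewrite -cY -(matching_sum YB fM).
  rewrite [RHS](bigID [in P]) /= [X in _ = _ + X]big1 ?addn0.
    by apply: eq_bigl => v; rewrite andb_idl // => /(subsetP PA).
  by move=> v /andP[vA]; rewrite inE vA /= lt0n negbK => /eqP.
rewrite exprVn -exprM => h.
have hM : 2 ^ (d * m) * #|M| <= #|Q| * 2 ^ (d * d ^ 2) * #|Om|.
  rewrite -(ler_nat rat) !natrM !natrX -(ler_pM2l (x := (2%:R ^+ (d * d ^ 2))^-1%R)); last by rewrite invr_gt0.
  rewrite mulrCA -ler_pdivlMl //; apply: le_trans (h _ _ _ _) _.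
  - move=> v w vP; rewrite inE => /andP[_ /eqP ->]; rewrite addn0 ler_pdivlMl // mulrC.
    by rewrite -natrX -natrM ler_nat; apply: hyperg_half; apply: sd.
  - by rewrite invr_gt0.
  - by rewrite invf_le1 // exprn_ege1 // ler1n.
  - by move=> v vP; rewrite lef_pV2 ?posrE // ler_weXn2l ?ler1n // sd.
  rewrite le_eqVlt; apply/orP; left; apply/eqP; have := tR (d * m); have := tR (d * d ^ 2).
  move: (2%:R ^+ (d * m))%R (2%:R ^+ (d * d ^ 2))%R => x y y0 x0.
  by field; rewrite !gt_eqF.
have hC : 'C(n, m) ^ 2 <= ((32 * d) ^ 2) ^ m.
  have hb : 'C(n, m) * m ^ m <= (32 * d) ^ m * m ^ m.
    apply: leq_trans (bin_mul_exp n m) _; rewrite -expnMn leq_exp2r //; clear hd; lia.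
  rewrite leq_pmul2r ?expn_gt0 ?m0 // in hb.
  by rewrite -expnM [2 * m]mulnC expnM leq_exp2r.
have h2 : 2 ^ (n %/ (8 * d)) <= 2 ^ m.
  rewrite leq_exp2l //; apply: (@leq_trans ((8 * d * m) %/ (8 * d))).
    by rewrite leq_div2r // -mulnA.
  by rewrite mulKn // muln_gt0 d0.
have h3 : 'C(n, m) ^ 2 * 2 ^ (n %/ (8 * d)) <= 2 ^ (d * m).
  apply: leq_trans (leq_mul hC h2) _; rewrite -expnMn expnM leq_exp2r //.
  by rewrite mulnC.
rewrite mulnAC; apply: leq_trans (leq_mul h3 (leqnn _)) _; apply: leq_trans hM _.
by rewrite leq_mul2r leq_mul2r -cA subset_leq_card ?orbT.
Qed.

(** At most [m] vertices have [s v = d], so nearly half of [A] has [0 < s v < d]. Any two of these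
    gain 2/3, and [n %/ 5] pairs beat the choices of sets of size at most [n / 1024]. *)
Lemma few_matching_spread : n <= 2 * #|[set v in A | 0 < s v]| -> 64 * 16 * m <= n ->
  'C(n, m) ^ 2 * #|M| * 2 ^ (n %/ 20) <= n * 3 ^ (d ^ 2) * #|Om|.
Proof.
move=> hpos hm.
have [->|[f fM]] := set_0Vmem M; first by rewrite cards0 muln0 mul0n.
pose P0 := [set v in A | 0 < s v < d]; pose F := [set v in A | s v == d].
have cF : #|F| <= m.
  rewrite -(leq_pmul2l d0) -cY -(matching_sum YB fM) mulnC -sum_nat_const.
  rewrite [X in _ <= X](bigID [in F]) /= -[X in X <= _]addn0 leq_add //.
  rewrite [X in _ <= X](eq_bigl [in F]) => [|v]; last by rewrite andb_idl // inE => /andP[].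
  by apply: leq_sum => v; rewrite inE => /andP[_ /eqP ->].
have cP0 : n <= 2 * (#|P0| + m).
  apply: leq_trans hpos _; rewrite leq_mul2l /=; apply: leq_trans (leq_add (leqnn _) cF).
  apply: leq_trans (leq_card_setU P0 F).1; apply: subset_leq_card; apply/subsetP => v.
  rewrite !inE => /andP[vA ->]; rewrite vA /= orbC -leq_eqVlt.
  exact: matching_le fM vA.
have [P PP0 cP] : exists2 P : {set T}, P \subset P0 & #|P| = n %/ 5.
  by apply: exists_subset_card; clear hd; lia.
pose Q := P0 :\: P.
have cQ : #|Q| = #|P0| - n %/ 5 by rewrite cardsD (setIidPr PP0) cP.
have P0A : P0 \subset A by apply/subsetP => v; rewrite inE => /andP[].
have QA : Q \subset A by apply: subset_trans (subsetDl _ _) P0A.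
have := @card_matching_pairs_const T A B Y P Q d s 2 3 (subset_trans PP0 P0A) QA.
rewrite -setI_eq0 setIDA [P :&: P0](setIidPl PP0) setDv eqxx cQ cP => /(_ isT) h.
have {}h := h ltac:(clear hd; lia) ltac:(clear hd; lia) isT.
have P0P v : v \in P0 -> 0 < s v < d by rewrite inE => /andP[].
have hM : 2 ^ (n %/ 5 %/ 2) * #|M| <= n * 3 ^ (d ^ 2) * #|Om|.
  (* Rests on [2 ^ 3 <= 3 ^ 2]: two factors 2/3 gain at least a factor 1/2. *)
  have h23 k r : 2 ^ (k * 2 + r) * 2 ^ k <= 3 ^ (k * 2 + r).
    rewrite -expnD (_ : k * 2 + r + k = 3 * k + r); last by lia.
    rewrite [k * 2]mulnC expnD [3 ^ _]expnD !expnM; apply: leq_mul; last by case: r => // r; rewrite leq_exp2r.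
    by case: k => // k; rewrite leq_exp2r.
  have {}h23 p : 2 ^ p * 2 ^ (p %/ 2) <= 3 ^ p by rewrite {1 3}(divn_eq p 2).
  rewrite -(leq_pmul2l (_ : 0 < 2 ^ (n %/ 5))) ?expn_gt0 // mulnA.
  apply: leq_trans (leq_mul (h23 _) (leqnn _)) _.
  apply: leq_trans (_ : _ <= 2 ^ d ^ 2 * 3 ^ (n %/ 5) * #|M|) _.
    by rewrite leq_mul2r leq_pmull ?expn_gt0 ?orbT.
  apply: leq_trans (h _) _ => [v w vP wQ|].
    have /andP[v0 vd] := P0P v (subsetP PP0 _ vP).
    have /andP[w0 wd] := P0P w (subsetP (subsetDl _ _) _ wQ).
    by apply: hyperg_nontrivial; [exact: ltnW | exact: ltnW | clear hd; lia].
  rewrite [(#|P0| - n %/ 5) * _]mulnC -!mulnA leq_mul2l; apply/orP; right.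
  by rewrite leq_mul2r; apply/orP; right; apply: leq_trans (leq_subr _ _) _; rewrite -cA subset_leq_card.
(* With [z = n %/ (64 * m) >= 16], the base [4 * n / m] is at most [256 * (z + 1) <= 2 ^ z], and
   [z * m <= n / 64]. *)
have hC : 'C(n, m) <= 2 ^ (n %/ (64 * m) * m).
  set z := n %/ (64 * m).
  have z16 : 16 <= z by rewrite /z leq_divRL ?muln_gt0 // mulnA [16 * _]mulnC.
  have hz : n < z.+1 * (64 * m) by rewrite -ltn_divLR ?muln_gt0.
  have h256 : 256 * z.+1 <= 2 ^ z.
    rewrite -(subnK z16) expnD; elim: (z - 16) => [|k IH]; first by [].
    rewrite addSn expnS -mulnA; apply: leq_trans _ (leq_mul (leqnn 2) IH).
    by clear; lia.
  have : 'C(n, m) * m ^ m <= (2 ^ z) ^ m * m ^ m.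
    apply: leq_trans (bin_mul_exp n m) _; rewrite -expnMn leq_exp2r //.
    apply: leq_trans _ (leq_mul h256 (leqnn m)); move: hz; clear; lia.
  by rewrite leq_pmul2r ?expn_gt0 ?m0 // -expnM.
have hz : 64 * (n %/ (64 * m) * m) <= n.
  by rewrite mulnCA leq_divM.
rewrite mulnAC; apply: leq_trans (leq_trans (leq_mul (_ : _ <= 2 ^ (n %/ 5 %/ 2)) (leqnn _)) hM) _ => //.
have hC2 : 'C(n, m) ^ 2 <= 2 ^ (n %/ (64 * m) * m * 2) by rewrite expnM leq_exp2r.
apply: leq_trans (leq_mul hC2 (leqnn _)) _; rewrite -expnD leq_exp2l //.
by move: hz hm m0; clear; move: (n %/ (64 * m) * m) => x; lia.
Qed.

(** The mean of [s] over [A] lies between [d / q] and [d / 2], so at least [n / (2 * q)] vertices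
    have [s v >= d / (2 * q)] and at least [n / 3] have [s v <= 3 * d / 4]. A pair of one of each
    kind is in the range of [hyp] and gains [2 ^ - k]. *)
Lemma few_matching_dense k q t :
  (forall d' a b, a <= d' -> b <= d' -> t <= a + b -> a + b + t <= 2 * d' ->
     2 ^ k * hyperg d' (a + b) a <= 'C(2 * d', d')) ->
  3 <= q -> k = 6 * q -> 2 * q * t <= d -> 4 * t <= d -> n <= q * m ->
  'C(n, m) ^ 2 * #|M| * 2 ^ n <= n * (2 ^ k * (2 ^ k) ^ (d ^ 2)) * #|Om|.
Proof.
move=> hyp q3 kq qt t4 hm.
have [->|[f fM]] := set_0Vmem M; first by rewrite cards0 muln0 mul0n.
have sd v : v \in A -> s v <= d by apply: matching_le fM.
have ssum := matching_sum YB fM; rewrite cY in ssum.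
pose Hi := [set v in A | d <= 2 * q * s v]; pose Lo := [set v in A | 4 * s v <= 3 * d].
have HiA : Hi \subset A by apply/subsetP => v; rewrite inE => /andP[].
have LoA : Lo \subset A by apply/subsetP => v; rewrite inE => /andP[].
have cHi : n <= 2 * q * #|Hi|.
  have : 2 * q * (d * m) <= #|Hi| * (2 * q * d) + n * d.
    rewrite -ssum big_distrr /= (bigID [in Hi]) /= leq_add //.
      rewrite -sum_nat_const (eq_bigl [in Hi]) => [|v]; last by rewrite andb_idl // => /(subsetP HiA).
      by apply: leq_sum => v /(subsetP HiA) vA; rewrite leq_mul2l sd ?orbT.
    apply: (@leq_trans (\sum_(v in A) d)); last by rewrite sum_nat_const cA.
    rewrite [X in _ <= X](bigID [in Hi]) /=; apply: leq_trans (leq_addl _ _).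
    by apply: leq_sum => v /andP[vA]; rewrite inE vA /= -ltnNge => /ltnW.
  rewrite mulnCA [#|Hi| * _]mulnCA [n * d]mulnC; move: (#|Hi|) hm d0; clear; nia.
have cLo : n <= 3 * #|Lo|.
  have : (n - #|Lo|) * (3 * d) <= 4 * (d * m).
    rewrite -ssum big_distrr /= -cA -{1}(setIidPr LoA) -cardsD -sum_nat_const.
    rewrite [X in _ <= X](bigID [in Lo]) /=; apply: leq_trans (leq_addl _ _).
    rewrite [X in _ <= X](eq_bigl [in A :\: Lo]) => [|v]; last by rewrite in_setD andbC.
    by apply: leq_sum => v; rewrite !inE => /andP[+ vA]; rewrite vA /= -ltnNge => /ltnW.
  have -> : 4 * (d * m) = (4 * m) * d by ring.
  rewrite mulnA leq_pmul2r // => h; clear hd; lia.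
have [P PHi cP] : exists2 P : {set T}, P \subset Hi & #|P| = n %/ (2 * q).
  apply: exists_subset_card; rewrite -ltnS ltn_divLR; [|clear hd; lia].
  by rewrite mulnC; apply: leq_ltn_trans cHi _; rewrite mulnS; clear hd; lia.
have qp : 2 * q * #|P| <= n by rewrite cP mulnC leq_divM.
have qp' : n < 2 * q * #|P|.+1 by rewrite cP mulnC -ltn_divLR //; clear hd; lia.
have p6 : 6 * #|P| <= n by apply: leq_trans qp; rewrite leq_mul2r; apply/orP; right; clear hd; lia.
pose Q := Lo :\: P.
have cQ : #|Lo| <= #|Q| + #|P|.
  by rewrite -(cardsID P Lo) addnC leq_add2l subset_leq_card // subsetIr.
have QA : Q \subset A by apply: subset_trans (subsetDl _ _) LoA.
have PA := subset_trans PHi HiA.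
have PQ : [disjoint P & Q].
  by rewrite -setI_eq0; apply/eqP/setP => v; rewrite in_setI in_setD in_set0; case: (v \in P).
have h := @card_matching_pairs_const T A B Y P Q d s 1 (2 ^ k) PA QA PQ.
have {}h := h ltac:(clear hd; lia) ltac:(clear hd; lia) (expn_gt0 2 k).
have q20 : 0 < 2 * q by rewrite muln_gt0; apply: leq_trans q3.
have hM : (2 ^ k) ^ #|P| * #|M| <= n * (2 ^ k) ^ (d ^ 2) * #|Om|.
  rewrite -[(2 ^ k) ^ #|P|]mul1n -{1}(exp1n (d ^ 2)); apply: leq_trans (h _) _ => [v w vP wQ|].
    have := subsetP PHi _ vP; have := subsetP (subsetDl _ _) _ wQ.
    rewrite !inE mul1n => /andP[wA hw] /andP[vA hv].
    have tv : t <= s v.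
      by rewrite -(leq_pmul2l q20); apply: leq_trans hv.
    have := sd _ vA; have := sd _ wA => ws vs.
    by apply: hyp => //; [exact: leq_trans tv (leq_addr _ _) | move: hw vs t4; clear; lia].
  by rewrite exp1n muln1 -!mulnA leq_mul2r -cA subset_leq_card ?orbT.
(* With [k = 6 * q], about [n / (2 * q)] pairs gain [2 ^ (3 * n)], against [2 ^ (2 * n)] choices;
   the extra [2 ^ k] covers the rounding in [#|P|]. *)
have e3 : 'C(n, m) ^ 2 * 2 ^ n <= 2 ^ k * (2 ^ k) ^ #|P|.
  apply: (@leq_trans ((2 ^ n) ^ 2 * 2 ^ n)); first by rewrite leq_mul2r leq_exp2r // bin_le_exp2 orbT.
  rewrite -!expnM -!expnD leq_exp2l // kq; move: qp'; rewrite mulnS; clear; lia.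
rewrite mulnAC; apply: leq_trans (leq_mul e3 (leqnn _)) _.
rewrite -mulnA; apply: leq_trans (leq_mul (leqnn _) hM) _.
by rewrite !mulnA leq_mul2r leq_mul2r [2 ^ k * n]mulnC leqnn !orbT.
Qed.
End Regimes.

(** * Joining the regimes, and the union bound *)

Lemma few_matching : exists d', 0 < d' /\ forall d, d' < d -> exists N, forall n, N <= n ->
  forall (T : finType) (A B Y : {set T}) (s : T -> nat), #|A| = n -> Y \subset B ->
  0 < #|Y| -> 2 * #|Y| <= n ->
  n ^ 2 * ('C(n, #|Y|) ^ 2 * #|matching A B d Y s|) <= 4 * d ^ 2 * #|row_families A B d|.
Proof.
(* [q] is the boundary between the spread and the dense regime; it fixes [t], hence how large [d]
   must be. *)
have [q eq] : exists q, 64 * 16 = q by eexists.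
have q3 : 3 <= q by rewrite -eq.
have [t ht] := hyperg_concentration (2 ^ (6 * q)).
have [N1 hN1] := exp2_dominates (2 * 32 ^ 2) 2 (isT : 0 < 1).
exists (N1 + 4 + 2 * q * t + 4 * t).+1; split=> // d hd.
have hd1 : 2 * (32 * d) ^ 2 <= 2 ^ d.
  by rewrite expnMn mulnA -[in 2 ^ d](divn1 d); apply: hN1; move: hd; clear; lia.
have d4 : 4 < d by move: hd; clear; lia.
have h1 : 4 * t <= d by move: hd; clear; lia.
have h2 : 2 * q * t <= d by move: hd; clear; move: (2 * q * t) => x; lia.
have d0 : 0 < d by apply: ltn_trans d4.
have c0 : 0 < 8 * d * 20 by rewrite !muln_gt0 d0.
pose D1 := 2 ^ (d * d ^ 2); pose D2 := 3 ^ (d ^ 2).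
pose D3 := 2 ^ (6 * q) * (2 ^ (6 * q)) ^ (d ^ 2).
have [N hN] := exp2_dominates (D1 + D2 + D3) 3 c0.
exists (N + 8 * d) => n hn T A B Y s cA YB Y0 Yn.
have nN : N <= n by apply: leq_trans hn; apply: leq_addr.
have n8 : 8 * d <= n by apply: leq_trans hn; apply: leq_addl.
have n0 : 0 < n by apply: leq_trans n8; rewrite muln_gt0 d0.
(* In the three pairing regimes the gain is exponential in [n] and outweighs [n ^ 3]; [8 * d * 20]
   gives an exponent below all three of theirs. *)
have fin D e : D <= D1 + D2 + D3 -> n %/ (8 * d * 20) <= e ->
    'C(n, #|Y|) ^ 2 * #|matching A B d Y s| * 2 ^ e <= n * D * #|row_families A B d| ->
    n ^ 2 * ('C(n, #|Y|) ^ 2 * #|matching A B d Y s|) <= 4 * d ^ 2 * #|row_families A B d|.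
  move=> hD he h; have p2 : 0 < 2 ^ e by rewrite expn_gt0.
  apply: (@leq_trans #|row_families A B d|); last by rewrite leq_pmull // muln_gt0 expn_gt0 d0.
  rewrite -(leq_pmul2r p2) -mulnA; apply: leq_trans (leq_mul (leqnn _) h) _.
  apply: (@leq_trans ((D1 + D2 + D3) * n ^ 3 * #|row_families A B d|)).
    have -> : n ^ 2 * (n * D * #|row_families A B d|) = D * n ^ 3 * #|row_families A B d| by ring.
    by rewrite leq_mul2r leq_mul2r hD !orbT.
  rewrite [X in _ <= X]mulnC leq_mul2r; apply/orP; right.
  by apply: leq_trans (hN n nN) _; rewrite leq_exp2l.
have [h8|h8] := leqP (8 * (d * #|Y|)) n; first exact: few_matching_small.
have [hq|hq] := leqP n (q * #|Y|).
  apply: (fin D3 n); [exact: leq_addl | exact: leq_div |].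
  exact: (few_matching_dense s cA erefl YB Y0 Yn d4 ht q3 erefl h2 h1 hq).
have [hs|hs] := leqP #|[set v in A | 0 < s v]| #|[set v in A | s v == 0]|.
  apply: (fin D1 (n %/ (8 * d))).
  - by rewrite -addnA leq_addr.
  - by rewrite divnMA leq_div.
  - by apply: few_matching_sparse => //; apply: ltnW.
apply: (fin D2 (n %/ 20)).
- by rewrite addnAC leq_addl.
- by rewrite mulnC divnMA leq_div.
apply: few_matching_spread => //; last by rewrite eq ltnW.
have sub : A \subset [set v in A | 0 < s v] :|: [set v in A | s v == 0].
  by apply/subsetP => v vA; rewrite !inE vA /=; case: (s v).
have := leq_trans (subset_leq_card sub) (leq_card_setU _ _).1; rewrite cA.
by move: hs; clear; lia.
Qed.

(** The profile may depend on [X], since a second partition prescribes it through [X] and the graph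
    on [A]. *)
Definition proper_matching (T : finType) (A B : {set T}) d (s : {set T} -> T -> nat)
    (f : {ffun T -> {set T}}) :=
  [exists X : {set T}, exists Y : {set T},
    [&& X \subset A, Y \subset B, #|X| == #|Y|, 0 < #|Y|, 2 * #|Y| <= #|A| &
        f \in matching A B d Y (s X)]].

(** For each [m], the sum over the ['C(n, m) ^ 2] pairs [(X, Y)] is a fraction at most
    [4 * d ^ 2 / n ^ 2] of all families, and [m] takes at most [n + 1 <= 2 * n] values. *)
Lemma few_proper_matching : exists d', 0 < d' /\ forall d, d' < d -> exists N, forall n, N <= n ->
  forall (T : finType) (A B : {set T}) (s : {set T} -> T -> nat), #|A| = n -> #|B| = n ->
  n * #|[set f in row_families A B d | proper_matching A B d s f]|
    <= 8 * d ^ 2 * #|row_families A B d|.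
Proof.
have [d' [d'0 h]] := few_matching; exists d'; split=> // d /h[N hN].
exists N.+1 => n hn T A B s cA cB; have n0 : 0 < n by apply: leq_trans hn.
set Om := row_families A B d; set Bad := [set f in Om | _].
pose D (S : {set T}) m := [set X : {set T} | X \subset S & #|X| == m].
pose ok (m : 'I_n.+1) := (0 < m) && (2 * m <= n).
pose F (m : 'I_n.+1) := \bigcup_(p in setX (D A m) (D B m)) matching A B d p.2 (s p.1).
have sub : Bad \subset \bigcup_(m in [set m | ok m]) F m.
  apply/subsetP => f; rewrite [f \in Bad]inE => /andP[_ /existsP[X /existsP[Y]]].
  case/and5P=> XA YB /eqP XY Y0 /andP[Yn fM]; rewrite cA in Yn.
  have Ylt : #|Y| < n.+1 by rewrite -cB ltnS subset_leq_card.
  apply/bigcupP; exists (Ordinal Ylt); first by rewrite inE /ok Y0.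
  by apply/bigcupP; exists (X, Y); rewrite // in_setX !inE XA YB XY eqxx.
have hF m : ok m -> n ^ 2 * #|F m| <= 4 * d ^ 2 * #|Om|.
  move=> /andP[m0 mn]; have C0 : 0 < 'C(n, m) ^ 2.
    by rewrite expn_gt0 bin_gt0; move: mn; clear; lia.
  rewrite -(leq_pmul2l C0).
  apply: leq_trans (leq_mul (leqnn _) (leq_mul (leqnn _) (leq_card_bigcup _ _))) _.
  have cD : 'C(n, m) ^ 2 = #|setX (D A m) (D B m)| by rewrite cardsX !cards_draws cA cB mulnn.
  rewrite !big_distrr /= [X in _ <= X * _]cD -sum_nat_const.
  apply: leq_sum => -[X Y]; rewrite in_setX !inE /= => /andP[/andP[_ _] /andP[YB /eqP cY]].
  by rewrite mulnCA -cY; apply: hN => //; rewrite ?cY // ltnW.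
have hB : n ^ 2 * #|Bad| <= n.+1 * (4 * d ^ 2 * #|Om|).
  apply: leq_trans (leq_mul (leqnn _) (leq_trans (subset_leq_card sub) (leq_card_bigcup _ _))) _.
  rewrite big_distrr /=; apply: (@leq_trans (\sum_(m in [set m | ok m]) 4 * d ^ 2 * #|Om|)).
    by apply: leq_sum => m; rewrite inE => /hF.
  rewrite sum_nat_const leq_mul2r; apply/orP; right.
  by rewrite -[X in _ <= X]card_ord max_card.
rewrite -(leq_pmul2l n0) mulnA mulnn; apply: leq_trans hB _.
have -> : n * (8 * d ^ 2 * #|Om|) = 2 * n * (4 * d ^ 2 * #|Om|) by ring.
by rewrite leq_mul2r; apply/orP; right; move: n0; clear; lia.

Qed.

(** * Bipartite edge sets versus row families *)

Section Translation.
Variables (T : finType) (A : {set T}) (d2 : nat).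
Implicit Types (H : {set T * T}) (f : {ffun T -> {set T}}).
Local Notation Om := (row_families A (~: A) d2).

Definition rows_of (H : {set T * T}) : {ffun T -> {set T}} :=
  [ffun v => if v \in A then [set u | (v, u) \in H] else set0].

(** Symmetrised, because an edge set holds each edge in both orders while rows record only the one
    starting in [A]. *)
Definition edges_of (f : {ffun T -> {set T}}) : {set T * T} :=
  [set e | (e.2 \in f e.1) || (e.1 \in f e.2)].

Lemma bip_regularP H : reflect
  [/\ forall x y, (x, y) \in H -> (x \in A) != (y \in A),
      forall x y, ((x, y) \in H) = ((y, x) \in H),
      forall v, v \in A -> #|[set u in ~: A | (v, u) \in H]| = d2 &
      forall v, v \notin A -> #|[set u in A | (v, u) \in H]| = d2]
  (bip_regular A (~: A) d2 H).
Proof.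
apply: (iffP and4P) => [[h1 /andP[/forallP h2 _] /forall_inP h3 /forall_inP h4]|[h1 h2 h3 h4]].
  split=> [x y xy|x y|v vA|v vA].
  - have := subsetP h1 _ xy; rewrite !inE /=.
    by case: (x \in A); case: (y \in A).
  - by have /forallP/(_ y)/eqP := h2 x.
  - exact/eqP/h3.
  - by apply/eqP/h4; rewrite inE.
split.
- by apply/subsetP => -[x y] /h1; rewrite !inE /=; case: (x \in A); case: (y \in A).
- apply/andP; split; apply/forallP => x; first by apply/forallP => y; rewrite h2.
  by apply/negP => /h1; rewrite eqxx.
- by apply/forall_inP => v /h3 h; apply/eqP.
- by apply/forall_inP => v; rewrite inE => /h4 h; apply/eqP.
Qed.

Lemma rows_of_in H : bip_regular A (~: A) d2 H -> rows_of H \in Om.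
Proof.
case/bip_regularP=> h1 h2 h3 h4.
have rA v u : v \in A -> (v, u) \in H -> u \in ~: A.
  by move=> vA /h1; rewrite vA inE; case: (u \in A).
apply/row_familiesP; split=> [v vA|v vA|v vA|b bB].
- by apply/subsetP => u; rewrite ffunE vA inE; apply: rA.
- by rewrite ffunE (negPf vA).
- rewrite ffunE vA -(h3 v vA); apply: eq_card => u; rewrite !inE.
  by rewrite andb_idl // => /(rA _ _ vA); rewrite inE.
- rewrite sum_mem_row -(h4 b); last by rewrite inE in bB.
  apply: eq_card => v; rewrite !inE ffunE h2; case: (v \in A); by rewrite inE.
Qed.

Lemma rows_ofK H : bip_regular A (~: A) d2 H -> edges_of (rows_of H) = H.
Proof.
case/bip_regularP=> h1 h2 _ _; apply/setP => -[x y]; rewrite inE /= !ffunE.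
have := h1 x y; rewrite (h2 x y).
case: (x \in A); case: (y \in A); rewrite !inE ?(h2 x y) //=; case: ((y, x) \in H) => //.
  by move/(_ isT).
Qed.

Lemma edges_of_regular f : f \in Om -> bip_regular A (~: A) d2 (edges_of f).
Proof.
case/row_familiesP=> h1 h2 h3 h4.
have fA x y : y \in f x -> (x \in A) && (y \notin A).
  case: (boolP (x \in A)) => [/h1/subsetP/(_ y)|/h2->]; last by rewrite inE.
  by rewrite inE.
apply/bip_regularP; split=> [x y|x y|v vA|v vA].
- by rewrite inE /= => /orP[/fA/andP[-> /negPf->]|/fA/andP[-> /negPf->]].
- by rewrite !inE /= orbC.
- rewrite -(h3 v vA); apply: eq_card => u; rewrite !inE /=.
  apply/andP/idP => [[uA /orP[//|/fA]]|uv]; first by rewrite vA andbF.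
  by have /andP[_ ->] := fA _ _ uv; rewrite uv.
- rewrite -(h4 v) ?inE // sum_mem_row; apply: eq_card => u; rewrite !inE /=.
  apply/andP/idP => [[uA /orP[/fA|//]]|uv]; first by rewrite (negPf vA).
  by have /andP[-> _] := fA _ _ uv; rewrite uv orbT.
Qed.

Lemma edges_ofK f : f \in Om -> rows_of (edges_of f) = f.
Proof.
case/row_familiesP=> h1 h2 _ _; apply/ffunP => v; rewrite ffunE.
case: (boolP (v \in A)) => [vA|/h2 -> //]; apply/setP => u; rewrite !inE /=.
case: (boolP (v \in f u)) => [|_]; last by rewrite orbF.
case: (boolP (u \in A)) => [/h1/subsetP/(_ v)|/h2->]; last by rewrite inE.
by rewrite inE vA => h /h.
Qed.

Lemma card_row_families_le :
  #|Om| <= #|[set H : {set T * T} | bip_regular A (~: A) d2 H]|.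
Proof.
rewrite -(card_in_imset (f := edges_of)) => [|f g fO gO e].
  by apply: subset_leq_card; apply/subsetP => _ /imsetP[f fO ->]; rewrite inE edges_of_regular.
by rewrite -(edges_ofK fO) e edges_ofK.
Qed.

End Translation.

(** * What a second partition forces *)

Section OtherPartition.
Variables (T : finType) (A : {set T}) (n d1 d2 : nat) (G1 G2 H : {set T * T}).
Hypotheses (cA : #|A| = n) (cT : #|T| = 2 * n).
Hypotheses (rG1 : regular_on A d1 G1) (rG2 : regular_on (~: A) d1 G2).
Hypothesis rH : bip_regular A (~: A) d2 H.
Local Notation G := (G1 :|: G2 :|: H).

(** The truncated subtractions are exact when [H] is matched by another partition. *)
Definition forced_degree (X : {set T}) (v : T) :=
  if v \in X then d2 - (d1 - #|[set u in X | (v, u) \in G1]|)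
  else d1 - #|[set u in A :\: X | (v, u) \in G1]|.

Let adjA v u : v \in A -> ((v, u) \in G) =
  if u \in A then (v, u) \in G1 else u \in rows_of A H v.
Proof.
move=> vA; have [h1 h2 _ _] := bip_regularP _ _ _ rH.
have /and3P[s1 _ _] := rG1; have /and3P[s2 _ _] := rG2.
have n2 : (v, u) \in G2 = false.
  by apply/negP => /(subsetP s2); rewrite !inE /= vA.
rewrite !in_setU n2 orbF ffunE vA inE; case: ifP => uA.
  by case: (boolP ((v, u) \in H)) => [/h1|_]; rewrite ?vA ?uA ?orbF.
by case: (boolP ((v, u) \in G1)) => [/(subsetP s1)|//]; rewrite in_setX uA andbF.
Qed.

(** The degrees inside both parts, stated in a form that passes to the complement of [W]. *)
Let self_regular (W : {set T}) := [/\ #|W| = n,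
  forall v, v \in W -> #|[set u in W | (v, u) \in G]| = d1 &
  forall v, v \notin W -> #|[set u in ~: W | (v, u) \in G]| = d1].

Let self_regularC W : self_regular W -> self_regular (~: W).
Proof.
move=> [h1 h2 h3]; split=> [|v|v]; first by rewrite cardsCs setCK h1 cT mul2n -addnn addnK.
  by rewrite inE => /h3.
by rewrite inE negbK setCK => /h2.
Qed.

Let sbm_self_regular W : sbm_partition n d1 d2 G W -> self_regular W.
Proof.
move=> /and4P[/eqP cW /and3P[_ _ /forall_inP r1] /and3P[_ _ /forall_inP r2] _]; split=> // v vW.
  rewrite -(eqP (r1 v vW)); apply: eq_card => u; rewrite !inE /= vW.
  by case: (u \in W); rewrite ?andbF ?andbT.
have vW' : v \in ~: W by rewrite inE.
rewrite -(eqP (r2 v vW')); apply: eq_card => u; rewrite !inE /= vW.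
by case: (u \in W); rewrite ?andbF ?andbT.
Qed.

(** If [v] lies in [W], its [d1] neighbours in [W] are those in [A :&: W] and those in [W :\: A]. If
    not, its [d1] neighbours outside [W] are those in [A :\: W] and the [H]-neighbours outside [W],
    which number [d2] minus the required count. *)
Let self_regular_matching W v : self_regular W -> v \in A ->
  #|rows_of A H v :&: (W :\: A)| = forced_degree (A :\: W) v.
Proof.
move=> [cW hin hout] vA.
have [rB _ rd _] := row_familiesP _ _ _ _ (rows_of_in rH).
have fB u : u \in rows_of A H v -> u \notin A by move=> /(subsetP (rB v vA)); rewrite inE.
have split_deg (S : {set T}) : #|[set u in S | (v, u) \in G]| =
    #|[set u in A :&: S | (v, u) \in G1]| + #|rows_of A H v :&: (S :\: A)|.
  have mem u : (u \in [set u in S | (v, u) \in G]) =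
      (u \in S) && (if u \in A then (v, u) \in G1 else u \in rows_of A H v).
    by rewrite in_set adjA.
  rewrite -(cardsID A); congr (_ + _); apply: eq_card => u.
    rewrite in_setI mem [RHS]in_set in_setI.
    by case: (u \in A); rewrite ?andbF // andbT.
  rewrite in_setD mem in_setI in_setD.
  by case: (boolP (u \in A)) => uA; rewrite /= ?andbF // andbC.
rewrite /forced_degree in_setD vA andbT; case: ifP => vW.
  have := hout v vW; rewrite split_deg -setDE.
  have : #|rows_of A H v| = #|rows_of A H v :&: (W :\: A)| + #|rows_of A H v :&: ((~: W) :\: A)|.
    rewrite -(cardsID W); congr (_ + _); apply: eq_card => u; rewrite !(in_setI, in_setD, in_setC);
    by case: (boolP (u \in rows_of A H v)) => [/fB ->|]; rewrite ?andbF ?andbT.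
  rewrite (rd v vA); clear; lia.
have := hin v (negbFE vW); rewrite split_deg.
have -> : A :\: (A :\: W) = A :&: W by rewrite setDDr setDv set0U.
clear; lia.
Qed.

Lemma not_unique_proper : ~~ unique_partition n d1 d2 G A ->
  proper_matching A (~: A) d2 forced_degree (rows_of A H).
Proof.
case/forallPn=> V; rewrite negb_imply negb_or => /and3P[/sbm_self_regular sV VA VcA].
(* [W] is [V] or its complement, whichever misses at most half of [A]; [V != ~: A] guarantees
   [W != A] in the second case. *)
have [W [sW WA hW]] : exists W, [/\ self_regular W, W != A & 2 * #|A :\: W| <= n].
  have [le|gt] := leqP (2 * #|A :\: V|) n; first by exists V.
  exists (~: V); split; first exact: self_regularC.
    by apply: contra_neq VcA => <-; rewrite setCK.
  rewrite setDE setCK; have := cardsID V A; rewrite cA; move: gt; clear; lia.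
have cXY : #|A :\: W| = #|W :\: A|.
  have [cW _ _] := sW; have := cardsID W A; have := cardsID A W.
  rewrite cW cA setIC; clear; lia.
apply/existsP; exists (A :\: W); apply/existsP; exists (W :\: A).
rewrite subsetDl cXY eqxx cA -cXY hW /=; apply/and3P; split.
- by apply/subsetP => u; rewrite !inE => /andP[].
- rewrite lt0n cards_eq0 setD_eq0; apply: contra_neqN WA => AW.
  by have [cW _ _] := sW; apply/esym/eqP; rewrite eqEcard AW cA cW leqnn.
- apply/matchingP; split; first exact: rows_of_in.
  by move=> v; apply: self_regular_matching.
Qed.

End OtherPartition.

(** * From row families to outcomes of the model *)

Section Counting.
Variables (n d1 d2 : nat) (A : {set vtx n}).
Hypothesis cA : #|A| = n.

(** Conditions on the graphs inside the two parts. The graph on [A] determines the profile, so the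
    bound, uniform in [s], applies to the remaining choice of [H]. *)
Lemma few_not_unique c : (forall s : {set vtx n} -> vtx n -> nat,
    n * #|[set f in row_families A (~: A) d2 | proper_matching A (~: A) d2 s f]|
      <= c * #|row_families A (~: A) d2|) ->
  n * #|[set t in sbm_outcomes n d1 d2 A | ~~ unique_partition n d1 d2 (sbm_graph n t) A]|
    <= c * #|sbm_outcomes n d1 d2 A|.
Proof.
move=> hc; have cT : #|vtx n| = 2 * n by rewrite card_ord.
pose bad p H := [&& regular_on A d1 p.1, regular_on (~: A) d1 p.2,
  bip_regular A (~: A) d2 H & ~~ unique_partition n d1 d2 (p.1 :|: p.2 :|: H) A].
pose out (p : {set vtx n * vtx n} * {set vtx n * vtx n}) H :=
  [&& regular_on A d1 p.1, regular_on (~: A) d1 p.2 & bip_regular A (~: A) d2 H].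
have -> : #|[set t in sbm_outcomes n d1 d2 A | ~~ unique_partition n d1 d2 (sbm_graph n t) A]|
    = \sum_p #|[set H | bad p H]|.
  rewrite -card_pairs; apply: eq_card => t; rewrite !inE /bad /sbm_graph.
  by rewrite -!andbA.
have -> : #|sbm_outcomes n d1 d2 A| = \sum_p #|[set H | out p H]|.
  by rewrite -card_pairs; apply: eq_card => t; rewrite !inE.
rewrite !big_distrr; apply: leq_sum => -[G1 G2] _ /=.
case: (boolP (regular_on A d1 G1 && regular_on (~: A) d1 G2)) => [/andP[r1 r2]|r]; last first.
  rewrite [#|[set H | bad _ H]|]eq_card0 ?muln0 // => H; rewrite inE /bad /=.
  by move: r; rewrite negb_and => /orP[] /negPf ->; rewrite ?andbF.
apply: (@leq_trans (c * #|row_families A (~: A) d2|)); last first.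
  rewrite leq_mul2l; apply/orP; right; apply: leq_trans (card_row_families_le _ _) _.
  by apply: subset_leq_card; apply/subsetP => H; rewrite !inE /out /= r1 r2.
apply: leq_trans (hc (forced_degree A d1 d2 G1)); rewrite leq_mul2l; apply/orP; right.
rewrite -(card_in_imset (f := rows_of A)).
  apply: subset_leq_card; apply/subsetP => _ /imsetP[H + ->].
  rewrite [H \in _]inE => /and4P[_ _ rH nu]; rewrite in_set rows_of_in //=.
  exact: not_unique_proper nu.
move=> H H'; rewrite [H \in _]inE [H' \in _]inE => /and4P[_ _ rH _] /and4P[_ _ rH' _] e.
by rewrite -(rows_ofK rH) e (rows_ofK rH').
Qed.

End Counting.

(** * Existence of regular graphs, by circulants *)

Section Circulant.
Variables (T : finType) (n : nat).
Local Open Scope ring_scope.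
Implicit Types (S : {set T}) (D : {set 'I_n.+1}).

(** Numbers [S] by the cyclic group ['I_n.+1], so that degrees of circulant graphs become sizes of
    subsets of the group. Labels outside [S] are arbitrary. *)
Lemma exists_labelling S : #|S| = n.+1 ->
  exists r : T -> 'I_n.+1, forall D, #|[set u in S | r u \in D]| = #|D|.
Proof.
move=> cS; pose r (u : T) : 'I_n.+1 := inord (index u (enum S)); exists r => D.
have rI : {in S &, injective r}.
  move=> u v uS vS /(congr1 val); rewrite /= !inordK -?cS ?cardE ?index_mem ?mem_enum //.
  by move=> e; rewrite -(nth_index u (s := enum S) (x := u)) ?mem_enum // e nth_index // mem_enum.
have rS : r @: S = setT.
  by apply/eqP; rewrite eqEcard subsetT cardsT card_ord (card_in_imset rI) cS /=.
have e : r @: [set u in S | r u \in D] = D.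
  apply/setP => k; apply/imsetP/idP => [[u + ->]|kD]; first by rewrite inE => /andP[].
  have : k \in r @: S by rewrite rS inE.
  by case/imsetP=> u uS ku; exists u => //; rewrite inE uS -ku.
by rewrite -[in RHS]e card_in_imset // => u v; rewrite !inE => /andP[uS _] /andP[vS _]; apply: rI.
Qed.

Lemma card_translate D (i : 'I_n.+1) : #|[set k | k - i \in D]| = #|D|.
Proof.
rewrite -(card_imset D (f := fun k => k + i)); last exact: addIr.
apply: eq_card => k; rewrite inE; apply/idP/imsetP => [h|[j jD ->]]; last by rewrite addrK.
by exists (k - i); rewrite // subrK.
Qed.

Lemma card_reflect D (i : 'I_n.+1) : #|[set k | i - k \in D]| = #|D|.
Proof.
rewrite -(card_imset D (f := fun k => i - k)); last by apply: inj_comp (addrI _) oppr_inj.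
apply: eq_card => k; rewrite inE; apply/idP/imsetP => [h|[j jD ->]]; last by rewrite subKr.
by exists (i - k); rewrite // subKr.
Qed.

Lemma card_interval lo d : (lo + d <= n.+1)%N ->
  #|[set k : 'I_n.+1 | lo <= k < lo + d]%N| = d.
Proof.
move=> h; rewrite -[RHS]card_ord -(card_imset _ (f := fun i : 'I_d => inord (lo + i) : 'I_n.+1)).
  apply: eq_card => k; rewrite inE; apply/andP/imsetP => [[h1 h2]|[i _ ->]].
    have hk : (k - lo < d)%N by move: h1 h2; clear; lia.
    by exists (Ordinal hk) => //; apply: val_inj; rewrite /= subnKC // inordK.
  have il := ltn_ord i; rewrite inordK; last by move: h il; clear; lia.
  by rewrite leq_addr ltn_add2l.
move=> i j /(congr1 val) /=; have il := ltn_ord i; have jl := ltn_ord j.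
rewrite !inordK; [|by move: h jl; clear; lia|by move: h il; clear; lia].
by move=> /addnI; apply: val_inj.
Qed.

Lemma val_opp (k : 'I_n.+1) : (0 < k)%N -> (- k : 'I_n.+1) = (n.+1 - k)%N :> nat.
Proof. by move=> k0; rewrite /= modn_small //; have := ltn_ord k; lia. Qed.

(** If [n + 1 + d] is odd, an interval of length [d] centred at [(n + 1) / 2] works. Otherwise
    [n + 1] and [d] are both even, and the midpoint, its own negative, is removed from such an
    interval of length [d + 1]. *)
Lemma exists_symmetric d : (d < n.+1)%N -> ~~ odd (n.+1 * d) ->
  exists D, [/\ #|D| = d, 0 \notin D & forall k, (- k \in D) = (k \in D)].
Proof.
pose I e : {set 'I_n.+1} := [set k : 'I_n.+1 | (n.+1 - e).+1./2 <= k < (n.+1 - e).+1./2 + e]%N.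
have I0 e : (e < n.+1)%N -> 0 \notin I e by move=> h; rewrite inE /=; lia.
have sym e k : (e < n.+1)%N -> odd (n.+1 + e) -> (- k \in I e) = (k \in I e).
  move=> en oe; have [k0|k0] := eqVneq (k : nat) 0%N.
    have -> : k = 0 by apply: val_inj.
    by rewrite oppr0.
  rewrite !inE val_opp ?lt0n //; have := ltn_ord k; move: k0 oe en; clear; move: (nat_of_ord k) => x; lia.
have cI e : (e < n.+1)%N -> odd (n.+1 + e) -> #|I e| = e.
  by move=> en oe; apply: card_interval; lia.
move=> dn odn; have [o|o] := boolP (odd (n.+1 + d)).
  by exists (I d); split; [exact: cI | exact: I0 | move=> k; apply: sym].
have on : ~~ odd n.+1 by move: odn o; rewrite oddM oddD; case: (odd _); case: (odd d).
have od : ~~ odd d by move: on o; rewrite oddD; case: (odd _); case: (odd d).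
have o' : odd (n.+1 + d.+1) by rewrite addnS /= -oddS; move: o; clear; lia.
have dn' : (d.+1 < n.+1)%N by move: on od dn; clear; lia.
have hn : (n.+1./2 < n.+1)%N by clear; lia.
pose h : 'I_n.+1 := Ordinal hn.
have hI : h \in I d.+1 by rewrite inE /=; move: on od dn'; clear; lia.
have hh : - h = h.
  apply: val_inj; rewrite /= -[RHS](@modn_small _ n.+1) //; congr (_ %% _)%N.
  by move: on; clear; lia.
exists (I d.+1 :\ h); split.
- by have := cardsD1 h (I d.+1); rewrite hI cI // add1n => -[].
- by rewrite in_setD1 (negPf (I0 _ dn')) andbF.
- by move=> k; rewrite !in_setD1 sym // -{1}hh (inj_eq oppr_inj).
Qed.

End Circulant.

Lemma exists_regular (T : finType) (S : {set T}) n d : #|S| = n -> d < n -> ~~ odd (n * d) ->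
  exists G, regular_on S d G.
Proof.
case: n => // n cS dn odn; have [r hr] := exists_labelling cS.
have [D [cD D0 sD]] := exists_symmetric dn odn.
exists [set e | [&& e.1 \in S, e.2 \in S & (r e.2 - r e.1)%R \in D]]; apply/and3P; split.
- by apply/subsetP => e; rewrite !inE => /and3P[-> ->].
- apply/andP; split; apply/forallP => x; last by rewrite inE /= subrr (negPf D0) !andbF.
  apply/forallP => y; rewrite !inE /= -(sD (r y - r x)%R) opprB.
  by case: (x \in S); rewrite ?andbF.
- apply/forall_inP => v vS; rewrite -cD -(card_translate D (r v)) -hr; apply/eqP.
  by apply: eq_card => u; rewrite !inE /= vS; case: (u \in S).
Qed.

Lemma exists_bip_regular (T : finType) (A : {set T}) n d : #|A| = n -> #|~: A| = n -> d <= n ->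
  0 < n -> exists H, bip_regular A (~: A) d H.
Proof.
case: n => // n cA cB dn _; have [r hr] := exists_labelling cA; have [r' hr'] := exists_labelling cB.
pose D := [set k : 'I_n.+1 | 0 <= k < 0 + d]; have cD : #|D| = d by apply: card_interval.
pose f : {ffun T -> {set T}} := [ffun v => [set u | [&& v \in A, u \in ~: A & (r' u - r v)%R \in D]]].
exists (edges_of f); apply: edges_of_regular; apply/row_familiesP; split=> [v vA|v vA|v vA|b bB].
- by rewrite ffunE; apply/subsetP => u; rewrite inE => /and3P[].
- by rewrite ffunE; apply/setP => u; rewrite [LHS]inE (negPf vA) in_set0.
- rewrite ffunE -cD -(card_translate D (r v)) -hr'; apply: eq_card => u.
  by rewrite !inE vA.
- rewrite sum_mem_row -cD -(card_reflect D (r' b)) -hr; apply: eq_card => v.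
  by rewrite inE ffunE inE bB [RHS]inE /= [X in _ = _ && X]inE.
Qed.

(** * Passing to probabilities *)

Local Open Scope ring_scope.

(** Division by zero yields 0 in [rat], so the quotient in [prob_unique] is a probability only for a
    nonempty outcome set; this is where the parity of [n * d1] enters. *)
Lemma sbm_outcomes_gt0 n d1 d2 (A : {set vtx n}) : #|A| = n -> (d1 < n)%N -> (d2 <= n)%N ->
  ~~ odd (n * d1) -> (0 < #|sbm_outcomes n d1 d2 A|)%N.
Proof.
move=> cA d1n d2n odn; have cB : #|~: A| = n by rewrite cardsCs setCK cA card_ord mul2n -addnn addnK.
have [G1 h1] := exists_regular cA d1n odn; have [G2 h2] := exists_regular cB d1n odn.
have [H h3] := exists_bip_regular cA cB d2n (leq_ltn_trans (leq0n _) d1n).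
by apply/card_gt0P; exists (G1, G2, H); rewrite inE h1 h2 h3.
Qed.

Theorem theorem1p3 :
  exists d' : nat, (0 < d')%N /\
  forall d1 d2 : nat, (d' < d2)%N -> (d2 < d1)%N ->
  forall eps : rat, 0 < eps ->
  exists N : nat, forall n : nat, (N <= n)%N -> ~~ odd (n * d1) ->
    1 - eps <= prob_unique n d1 d2.
Proof.
have [d' [d'0 hd']] := few_proper_matching; exists d'; split=> // d1 d2 hd2 hd1 eps eps0.
have [N hN] := hd' d2 hd2; set c := (8 * d2 ^ 2)%N in hN.
(* The failure probability is at most [c / n], hence at most [eps] from [K] on. *)
pose K := Num.bound (c%:R / eps).
have hK : c%:R / eps < K%:R by apply: archi_boundP; rewrite divr_ge0 // ltW.
exists (N + K + d1.+1)%N => n hn odn.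
have nN : (N <= n)%N by move: hn; clear; lia.
have nK : (K <= n)%N by move: hn; clear; lia.
have nd1 : (d1 < n)%N by move: hn; clear; lia.
have n0 : (0 < n)%N by apply: leq_ltn_trans nd1.
have hcn : c%:R <= eps * n%:R.
  rewrite -ler_pdivrMl // mulrC; apply: le_trans (ltW hK) _; by rewrite ler_nat.
(* The bound holds for every true part [A], so it survives averaging over [A]. *)
have perA (A : {set vtx n}) : #|A| == n -> 1 - eps <=
    (#|[set t in sbm_outcomes n d1 d2 A | unique_partition n d1 d2 (sbm_graph n t) A]|%:R : rat)
      / #|sbm_outcomes n d1 d2 A|%:R.
  move=> /eqP cA; have cB : #|~: A| = n by rewrite cardsCs setCK cA card_ord mul2n -addnn addnK.
  have t0 := sbm_outcomes_gt0 cA nd1 (ltnW (ltn_trans hd1 nd1)) odn.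
  have tR : 0 < #|sbm_outcomes n d1 d2 A|%:R :> rat by rewrite ltr0n.
  have := few_not_unique d1 cA (c := c) (fun s => hN n nN _ A (~: A) s cA cB).
  set Out := sbm_outcomes n d1 d2 A in t0 tR *; set U := [set t in Out | unique_partition _ _ _ _ _].
  set NU := [set t in Out | ~~ _] => hNU.
  have cUN : (#|Out| = #|U| + #|NU|)%N.
    rewrite -(cardsID [set t | unique_partition n d1 d2 (sbm_graph n t) A] Out); congr addn.
      by apply: eq_card => t; rewrite in_setI [RHS]in_set [X in _ && X]in_set.
    by apply: eq_card => t; rewrite in_setD [RHS]in_set [X in ~~ X]in_set andbC.
  rewrite ler_pdivlMr // mulrBl mul1r lerBlDr cUN natrD lerD2l -natrD -cUN.
  have nR : 0 < n%:R :> rat by rewrite ltr0n.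
  rewrite -(ler_pM2l nR); apply: (@le_trans _ _ (c%:R * #|Out|%:R)).
    by rewrite -!natrM ler_nat.
  by rewrite mulrCA mulrA ler_pM2r // mulrC mulrC.
have cntP : (0 < #|[set A : {set vtx n} | #|A| == n]|)%N.
  have -> : #|[set A : {set vtx n} | #|A| == n]| = 'C(2 * n, n).
    transitivity 'C(#|[set: vtx n]|, n); last by rewrite cardsT card_ord.
    rewrite -cards_draws; apply: eq_card => A.
    by rewrite !inE subsetT.
  by rewrite bin_gt0 leq_pmull.
rewrite /prob_unique ler_pdivlMr ?ltr0n //.
rewrite mulr_natr -sumr_const; under eq_bigl do rewrite inE.
exact: ler_sum.
Qed.
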